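(* Let $\mathcal{V}$ be a variety of lattices. Then $\mathsf{D}_4$ is sharply transferable with respect to $\mathcal{V}$ if and only if $\mathcal{V}\subseteq\mathcal{M}_\omega$.
   Context: $\mathsf{D}_4$ is the seven-element lattice $\{0,\mathsf{a}_0,\mathsf{a}_1,\mathsf{c},\mathsf{b}_0,\mathsf{b}_1,1\}$ with $\mathsf{a}_0,\mathsf{a}_1$ incomparable, $\mathsf{b}_0,\mathsf{b}_1$ incomparable, $\mathsf{a}_0\wedge\mathsf{a}_1=0$, $\mathsf{a}_0\vee\mathsf{a}_1=\mathsf{c}=\mathsf{b}_0\wedge\mathsf{b}_1$, $\mathsf{b}_0\vee\mathsf{b}_1=1$ (two squares glued top-to-bottom). $\mathcal{M}_\omega$ is the lattice variety generated by all lattices of length $2$. An ideal of a lattice $L$ is a nonempty subset $I$ with $x\vee y\in I$ iff $x,y\in I$; $\mathrm{Id}\,L$ is the lattice of ideals under inclusion. A lattice $P$ is sharply transferable with respect to a class $\mathcal{C}$ if for every $L\in\mathcal{C}$ and every lattice embedding $\varphi\colon P\to\mathrm{Id}\,L$ there is a lattice homomorphism $f\colon P\to L$ with $f(x)\in\varphi(x)$ for all $x$, such that $f(x)\in\varphi(y)$ implies $x\leq y$ for all $x,y\in P$. *)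

(* Defs.v *)
From HB Require Import structures.
From mathcomp Require Import all_boot all_order.
From mathcomp Require Import boolp classical_sets.

Set Implicit Arguments.
Unset Strict Implicit.
Unset Printing Implicit Defensive.

Import Order.TTheory.
Local Open Scope order_scope.

Inductive D4 : Type := D4_0 | D4_a0 | D4_a1 | D4_c | D4_b0 | D4_b1 | D4_1.

Definition D4_pickle (x : D4) : nat :=
  match x with
  | D4_0 => 0 | D4_a0 => 1 | D4_a1 => 2 | D4_c => 3
  | D4_b0 => 4 | D4_b1 => 5 | D4_1 => 6
  end.

Definition D4_unpickle (n : nat) : D4 :=
  nth D4_1 [:: D4_0; D4_a0; D4_a1; D4_c; D4_b0; D4_b1] n.

Lemma D4_pickleK : cancel D4_pickle D4_unpickle.
Proof. by case. Qed.

HB.instance Definition _ := Countable.copy D4 (can_type D4_pickleK).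

Lemma D4_enumP :
  Finite.axiom [:: D4_0; D4_a0; D4_a1; D4_c; D4_b0; D4_b1; D4_1].
Proof. by case. Qed.

HB.instance Definition _ := isFinite.Build D4 D4_enumP.

Definition D4_le (x y : D4) : bool :=
  match x, y with
  | D4_0, _ | _, D4_1 => true
  | (D4_a0 | D4_a1), (D4_c | D4_b0 | D4_b1) => true
  | D4_c, (D4_c | D4_b0 | D4_b1) => true
  | _, _ => x == y
  end.

Lemma D4_le_refl : reflexive D4_le.
Proof. by case. Qed.

Lemma D4_le_anti : antisymmetric D4_le.
Proof. by do 2!case. Qed.

Lemma D4_le_trans : transitive D4_le.
Proof. by do 3!case. Qed.

Fact D4_display : Order.disp_t. Proof. exact: Order.Disp tt tt. Qed.

HB.instance Definition _ :=
  Order.Le_isPOrder.Build D4_display D4 D4_le_refl D4_le_anti D4_le_trans.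

(* The only incomparable pairs are {a0, a1} and {b0, b1}. *)
Definition D4_meet (x y : D4) : D4 :=
  if D4_le x y then x else if D4_le y x then y else
  if x is (D4_a0 | D4_a1) then D4_0 else D4_c.

Definition D4_join (x y : D4) : D4 :=
  if D4_le x y then y else if D4_le y x then x else
  if x is (D4_a0 | D4_a1) then D4_c else D4_1.

Lemma D4_lexI (x y z : D4) : (x <= D4_meet y z) = (x <= y) && (x <= z).
Proof. by case: x; case: y; case: z. Qed.

Lemma D4_leUx (x y z : D4) : (D4_join x y <= z) = (x <= z) && (y <= z).
Proof. by case: x; case: y; case: z. Qed.

HB.instance Definition _ :=
  Order.POrder_MeetJoin_isLattice.Build D4_display D4 D4_lexI D4_leUx.

Lemma D4_relations :
  [/\ ~~ (D4_a0 >=< D4_a1), ~~ (D4_b0 >=< D4_b1),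
      D4_a0 `&` D4_a1 = D4_0 /\ D4_a0 `|` D4_a1 = D4_c
    & D4_b0 `&` D4_b1 = D4_c /\ D4_b0 `|` D4_b1 = D4_1].
Proof. by []. Qed.

Section Ideals.
Context {d : Order.disp_t} {L : latticeType d}.

Record ideal : Type := Ideal {
  ideal_set :> set L;
  ideal_nonempty : (ideal_set !=set0)%classic;
  ideal_joinE : forall x y, ideal_set (x `|` y) <-> ideal_set x /\ ideal_set y
}.

Implicit Types I J K : ideal.

Lemma ideal_inj I J : (I : set L) = J -> I = J.
Proof.
case: I J => [I I0 IU] [J J0 JU] /= eIJ; move: J0 JU; rewrite -eIJ => J0 JU.
by congr Ideal; exact: Prop_irrelevance.
Qed.

Lemma ideal_down I x y : x <= y -> ideal_set I y -> ideal_set I x.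
Proof. by move=> /join_idPl <- /ideal_joinE[]. Qed.

HB.instance Definition _ := gen_eqMixin ideal.
HB.instance Definition _ := gen_choiceMixin ideal.

Definition ideal_le I J : bool := `[< (I `<=` J)%classic >].

Lemma ideal_le_refl : reflexive ideal_le.
Proof. by move=> I; apply/asboolP. Qed.

Lemma ideal_le_anti : antisymmetric ideal_le.
Proof.
by move=> I J /andP[/asboolP IJ /asboolP JI]; apply/ideal_inj/seteqP.
Qed.

Lemma ideal_le_trans : transitive ideal_le.
Proof.
move=> J I K /asboolP IJ /asboolP JK.
by apply/asboolP; exact: subset_trans IJ JK.
Qed.

HB.instance Definition _ :=
  Order.Le_isPOrder.Build d ideal ideal_le_refl ideal_le_anti ideal_le_trans.

Lemma ideal_leP I J : reflect (I `<=` J)%classic (I <= J).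
Proof. exact: asboolP. Qed.

Definition ideal_meet_set I J : set L := (I `&` J)%classic.

Lemma ideal_meet_nonempty I J : (ideal_meet_set I J !=set0)%classic.
Proof.
have [[x Ix] [y Jy]] := (ideal_nonempty I, ideal_nonempty J).
exists (x `&` y); split.
  by apply: ideal_down Ix; exact: leIl.
by apply: ideal_down Jy; exact: leIr.
Qed.

Lemma ideal_meet_joinE I J x y :
  ideal_meet_set I J (x `|` y) <-> ideal_meet_set I J x /\ ideal_meet_set I J y.
Proof.
split; first by move=> [/ideal_joinE[? ?] /ideal_joinE[? ?]].
by move=> [[? ?] [? ?]]; split; apply/ideal_joinE.
Qed.

Definition ideal_meet I J : ideal :=
  Ideal (ideal_meet_nonempty I J) (@ideal_meet_joinE I J).

Definition ideal_join_set I J : set L :=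
  fun z => exists x y, [/\ ideal_set I x, ideal_set J y & z <= x `|` y].

Lemma ideal_join_nonempty I J : (ideal_join_set I J !=set0)%classic.
Proof.
have [[x Ix] [y Jy]] := (ideal_nonempty I, ideal_nonempty J).
by exists (x `|` y), x, y.
Qed.

Lemma ideal_join_joinE I J x y :
  ideal_join_set I J (x `|` y) <-> ideal_join_set I J x /\ ideal_join_set I J y.
Proof.
split=> [[u [v [Iu Jv]]]|[[u [v [Iu Jv xuv]]] [u' [v' [Iu' Jv' yuv']]]]].
  by rewrite leUx => /andP[xuv yuv]; split; exists u, v.
exists (u `|` u'), (v `|` v'); split; try exact/ideal_joinE.
by rewrite joinACA leU2.
Qed.

Definition ideal_join I J : ideal :=
  Ideal (ideal_join_nonempty I J) (@ideal_join_joinE I J).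

Lemma ideal_lexI I J K : (I <= ideal_meet J K) = (I <= J) && (I <= K).
Proof.
apply/ideal_leP/andP => [IJK|[/ideal_leP IJ /ideal_leP IK] x Ix].
  by split; apply/ideal_leP => x /IJK[].
by split; [exact: IJ|exact: IK].
Qed.

Lemma ideal_leUx I J K : (ideal_join I J <= K) = (I <= K) && (J <= K).
Proof.
have [[x0 Ix0] [y0 Jy0]] := (ideal_nonempty I, ideal_nonempty J).
apply/ideal_leP/andP => [IJK|[/ideal_leP IK /ideal_leP JK] z].
  split; apply/ideal_leP => x Hx; apply: IJK.
    by exists x, y0; rewrite leUl.
  by exists x0, x; rewrite leUr.
move=> [x [y [Ix Jy zxy]]]; apply: ideal_down zxy _.
by apply/ideal_joinE; split; [exact: IK|exact: JK].
Qed.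

HB.instance Definition _ :=
  Order.POrder_MeetJoin_isLattice.Build d ideal ideal_lexI ideal_leUx.

End Ideals.

Arguments ideal {d} L.

Definition lattice_class : Type :=
  forall d : Order.disp_t, latticeType d -> Prop.

Definition subclass (C C' : lattice_class) : Prop :=
  forall (d : Order.disp_t) (L : latticeType d), C d L -> C' d L.

Inductive lattice_term : Type :=
  | Var of nat
  | Meet of lattice_term & lattice_term
  | Join of lattice_term & lattice_term.

Fixpoint lattice_eval (d : Order.disp_t) (L : latticeType d) (v : nat -> L)
    (t : lattice_term) : L :=
  match t with
  | Var n => v n
  | Meet t1 t2 => lattice_eval v t1 `&` lattice_eval v t2
  | Join t1 t2 => lattice_eval v t1 `|` lattice_eval v t2
  end.

Definition satisfies (d : Order.disp_t) (L : latticeType d)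
    (E : set (lattice_term * lattice_term)) : Prop :=
  forall e, E e -> forall v : nat -> L,
    lattice_eval v e.1 = lattice_eval v e.2.

Definition is_variety (V : lattice_class) : Prop :=
  exists E : set (lattice_term * lattice_term),
    forall (d : Order.disp_t) (L : latticeType d), V d L <-> satisfies L E.

Definition variety_generated_by (C : lattice_class) : lattice_class :=
  fun d L => forall V, is_variety V -> subclass C V -> V d L.

(* A chain with m elements is given by its increasing enumeration; its length
   is m - 1. *)
Definition has_length (n : nat) : lattice_class :=
  fun d L => (exists s : seq L, sorted <%O s /\ size s = n.+1) /\
             (forall s : seq L, sorted <%O s -> (size s <= n.+1)%N).

Definition M_omega : lattice_class := variety_generated_by (has_length 2).

Definition sharply_transferable (dP : Order.disp_t) (P : latticeType dP)
    (C : lattice_class) : Prop :=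
  forall (d : Order.disp_t) (L : latticeType d), C d L ->
  forall phi : {lmorphism P -> ideal L}, injective phi ->
  exists f : {lmorphism P -> L},
    (forall x, ideal_set (phi x) (f x)) /\
    (forall x y, ideal_set (phi y) (f x) -> x <= y).

(* Main.v *)
Require Import Defs.
From HB Require Import structures.
From mathcomp Require Import all_boot all_order.
From mathcomp Require Import generic_quotient boolp classical_sets.

(* If V is contained in M_omega, start from b0, b1 in phi(b0), phi(b1) and
   enlarge twice: elements of phi(a0), phi(a1) whose join exceeds b0 /\ b1 (and
   then its successor v) yield explicit lattice terms p0, p1, q0, q1 with
   p0 \/ p1 = q0 /\ q1.  In a lattice of length 2 the chain of approximations
   can jump only twice, so the equation holds there, hence in all of M_omega.

   Conversely, transferability is tested on lattices of pairs (x, s), where x is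
   in D4 and s is a sequence in a member K of V that is eventually equal to a
   prescribed floor, while the condition "s n <= m or e <= s (n+1)" propagates
   upwards any jump of s.  The projection to D4 has no section unless K obeys a
   certain implication.  One instance of it is the modular law; another one says
   that no diamond (sublattice M3) sits on an edge of another diamond.  In a
   modular lattice of the second kind, each diamond [b, t] makes
   u |-> (u /\ t) \/ b an endomorphism, and the kernel of this map meets trivially
   a congruence collapsing b and t.  So in a subdirectly irreducible quotient
   every diamond spans the whole lattice, which then has length at most 2. *)

Set Implicit Arguments.
Unset Strict Implicit.
Unset Printing Implicit Defensive.

Import Order.TTheory.
Local Open Scope order_scope.

(** * Modular lattices and diamonds *)

Ltac lat_step n :=
  lazymatch n with
  | O => fail
  | S ?k =>
    lazymatch goal with
    | |- is_true (?x <= ?x) => exact: lexx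
    | |- is_true (_ `|` _ <= _) => rewrite leUx; apply/andP; split; lat_step n
    | |- is_true (_ <= _ `&` _) => rewrite lexI; apply/andP; split; lat_step n
    | |- _ =>
      first
        [ assumption
        | apply: lexUl; lat_step k
        | apply: lexUr; lat_step k
        | apply: leIxl; lat_step k
        | apply: leIxr; lat_step k
        | match goal with
          | H : is_true (?a <= ?b) |- is_true (?a <= ?t) =>
              apply: (le_trans H); clear H; lat_step k
          | H : is_true (?a <= ?b) |- is_true (?s <= ?b) =>
              apply: (le_trans _ H); clear H; lat_step k
          end ]
    end
  end.

(* Whitman's algorithm for lattice inequalities, with hypotheses [a <= b] used
   as extra transitivity steps; iterative deepening bounds the search. *)
Ltac lat :=
  first [lat_step 2%nat | lat_step 3%nat | lat_step 4%nat | lat_step 5%nat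
        | lat_step 8%nat].

Definition modular d (L : latticeType d) : Prop :=
  forall p q r : L, p <= q -> q `&` (p `|` r) <= p `|` (q `&` r).

(* Fails when the upper edge of the diamond generated by [al], [be], [e] is
   carried by [_ `|` j], j = (z `&` m) `|` (y `&` m), onto a lower edge of the
   diamond generated by [m], [y], [z]. *)
Definition no_linked_diamonds d (L : latticeType d) : Prop :=
  forall al be e m y z : L,
    al <= m -> be <= m -> e <= m -> e <= y -> e <= z ->
    al `&` be <= e -> al `|` be <= y `|` z ->
    (al `|` e) `&` (be `|` e) <= (z `&` m) `|` (y `&` m).

(** The degenerate case [b = t] is allowed; results about a genuine M3 add [b < t]. *)
Definition diamond d (L : latticeType d) (b x y z t : L) : Prop :=
  [/\ x `&` y = b, y `&` z = b & x `&` z = b] /\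
  [/\ x `|` y = t, y `|` z = t & x `|` z = t].

Section Modular.
Context {d : Order.disp_t} {L : latticeType d}.
Implicit Types (s t w x y z : L).

Lemma modular_dual : modular L -> modular L^d.
Proof. by move=> modL p q r le_qp; exact: (modL q p r le_qp). Qed.

Lemma diamond_dual b x y z t : diamond b x y z t -> @diamond _ L^d t x y z b.
Proof. by move=> [[? ? ?] [? ? ?]]; split; split. Qed.


Lemma modularE x y z : modular L -> x <= y ->
  y `&` (x `|` z) = x `|` (y `&` z).
Proof. by move=> modL le_xy; apply/le_anti/andP; split; [exact: modL|lat]. Qed.

Lemma modular_cancel x y z : modular L -> x <= y ->
  y `&` z <= x -> y <= x `|` z -> x = y.
Proof.
move=> modL le_xy le_yzx le_yxz; apply/le_anti/andP; split=> //.
have := modL _ _ z le_xy; rewrite (meet_l le_yxz) => /le_trans; apply.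
by lat.
Qed.

Lemma modular_median x y z : modular L ->
  (x `|` (y `&` z)) `&` (y `|` (x `&` z)) <=
  (x `&` y) `|` ((y `&` z) `|` (x `&` z)).
Proof.
move=> modL.
have h1 := modL (y `&` z) (y `|` (x `&` z)) x ltac:(lat).
have h2 := modL (x `&` z) x y ltac:(lat).
have h3 : (y `|` x `&` z) `&` x <= (x `&` z) `|` (x `&` y) by apply: le_trans h2; lat.
have h4 : (x `|` y `&` z) `&` (y `|` x `&` z) <=
  (y `|` x `&` z) `&` (y `&` z `|` x) by lat.
apply: (le_trans h4); apply: (le_trans h1); rewrite leUx; apply/andP; split; first by lat.
by apply: (le_trans h3); lat.
Qed.

End Modular.

Lemma modular_median_dual d (L : latticeType d) (x y z : L) : modular L ->
  (x `|` y) `&` ((y `|` z) `&` (x `|` z)) <=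
  (x `&` (y `|` z)) `|` (y `&` (x `|` z)).
Proof. by move=> modL; exact: (@modular_median _ L^d x y z (modular_dual modL)). Qed.

Lemma nondistributive_diamond d (L : latticeType d) (x y z : L) : modular L ->
  ~~ (x `&` (y `|` z) <= (x `&` y) `|` (x `&` z)) ->
  exists b u v w t : L, diamond b u v w t /\ b < t.
Proof.
move=> modL ndist.
pose b := (x `&` y) `|` ((y `&` z) `|` (x `&` z)).
pose t := (x `|` y) `&` ((y `|` z) `&` (x `|` z)).
have le_bt : b <= t by rewrite /b /t; lat.
have bE (u v w : L) : (u `|` (v `&` w)) `&` (v `|` (u `&` w)) <=
    (u `&` v) `|` ((v `&` w) `|` (u `&` w)) by exact: modular_median.
have tE (u v w : L) : (u `|` v) `&` ((v `|` w) `&` (u `|` w)) <=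
  (u `&` (v `|` w)) `|` (v `&` (u `|` w)) by exact: modular_median_dual.
pose f u := (u `&` t) `|` b.
have fE u : f u = (u `|` b) `&` t.
  by rewrite /f [RHS]meetC joinC (joinC u b) modularE // [t `&` u]meetC.
have meetP (u v w : L) : b = (u `&` v) `|` ((v `&` w) `|` (u `&` w)) ->
    f u `&` f v = b.
  move=> bE'; apply/le_anti/andP; split; last by rewrite /f; lat.
  have h := bE u v w; rewrite -bE' in h; apply: le_trans h.
  rewrite !fE lexI; apply/andP; split.
    by apply: leIxl; apply: leIxl; rewrite bE'; lat.
  by apply: leIxr; apply: leIxl; rewrite bE'; lat.
have joinP (u v w : L) : t = (u `|` v) `&` ((v `|` w) `&` (u `|` w)) ->
    f u `|` f v = t.
  move=> tE'; apply/le_anti/andP; split; first by rewrite /f; lat.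
  have h := tE u v w; rewrite -tE' in h; apply: (le_trans h).
  rewrite leUx; apply/andP; split.
    by apply: lexUl; apply: lexUl; rewrite tE'; lat.
  by apply: lexUr; apply: lexUl; rewrite tE'; lat.
have eqle (u v : L) : u <= v -> v <= u -> u = v.
  by move=> *; apply/le_anti/andP.
exists b, (f x), (f y), (f z), t; split; first split; first split.
- exact: (@meetP x y z).
- by apply: (@meetP y z x); apply: eqle; rewrite /b; lat.
- by apply: (@meetP x z y); apply: eqle; rewrite /b; lat.
- split.
  + exact: (@joinP x y z).
  + by apply: (@joinP y z x); apply: eqle; rewrite /t; lat.
  + by apply: (@joinP x z y); apply: eqle; rewrite /t; lat.
(* If [b = t], then [x /\ (y \/ z)] lies below [x /\ b], which the modular law brings under
   [(x /\ y) \/ (x /\ z)]. *)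
rewrite lt_neqAle le_bt andbT; apply: contra ndist => /eqP eq_bt.
have h : x `&` (y `|` z) <= x `&` b by rewrite eq_bt /t; lat.
apply: (le_trans h).
have h2 := modL ((x `&` y) `|` (x `&` z)) x (y `&` z) ltac:(lat).
have h3 : x `&` b <= x `&` ((x `&` y) `|` (x `&` z) `|` (y `&` z)).
  by rewrite /b; lat.
by apply: (le_trans h3); apply: (le_trans h2); lat.
Qed.

(** * Consequences of the absence of linked diamonds *)

Section LinkedDiamonds.
Context {d : Order.disp_t} {L : latticeType d}.
Implicit Types (s t w x y z : L).

(** Dualizing exchanges the pair [al], [be] with the pair [y], [z], and [e] with [m]. The new [e]
    must lie above the meet of the new pair, hence the summand [y /\ z]. *)
Lemma no_linked_diamonds_dual :
  modular L -> no_linked_diamonds L -> no_linked_diamonds L^d.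
Proof.
move=> modL nldL; change (forall al be e m y z : L, m <= al -> m <= be -> m <= e -> y <= e -> z <= e ->
  e <= al `|` be -> y `&` z <= al `&` be ->
  (z `|` m) `&` (y `|` m) <= (al `&` e) `|` (be `&` e)).
move=> al be e m y z.
move=> m_al m_be m_e y_e z_e e_albe yz_albe.
have h := nldL y z (m `|` (y `&` z)) e be al y_e z_e
  ltac:(lat) ltac:(lat) ltac:(lat) ltac:(lat) ltac:(lat).
by apply: le_trans h; lat.
Qed.

Lemma diamond_sub b x y z t : diamond b x y z t ->
  [/\ b <= x, b <= y, b <= z, x <= t & y <= t] /\ z <= t.
Proof.
move=> [[xy yz xz] [jxy jyz jxz]].
have b_x : b <= x by rewrite -xy leIl.
have b_y : b <= y by rewrite -xy leIr.
have b_z : b <= z by rewrite -yz leIr.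
have x_t : x <= t by rewrite -jxy leUl.
have y_t : y <= t by rewrite -jxy leUr.
have z_t : z <= t by rewrite -jyz leUr.
by [].
Qed.

Lemma diamond_rot b x y z t : diamond b x y z t -> diamond b y z x t.
Proof.
move=> [[? ? ?] [? ? ?]]; split; split=> //.
- by rewrite meetC.
- by rewrite meetC.
- by rewrite joinC.
- by rewrite joinC.
Qed.

(** This makes the projection onto [[b, t]] preserve joins. First [g <= x1 \/ g'] for every side
    [x1] of the diamond; then two sides cut down to [g], together with [g'], allow a second use of
    [no_linked_diamonds]. *)
Lemma diamond_joinI b x y z t u v : modular L -> no_linked_diamonds L ->
  diamond b x y z t -> b <= u -> b <= v ->
  (u `|` v) `&` t <= (u `&` t) `|` (v `&` t).
Proof.
move=> modL nldL dia b_u b_v.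
pose g := (u `|` v) `&` t; pose g' := (u `&` t) `|` (v `&` t).
have b_g' : b <= g'.
  have [[b_x _ _ x_t _] _] := diamond_sub dia.
  by apply: lexUl; rewrite lexI b_u /=; apply: le_trans x_t.
have g'_g : g' <= g by rewrite /g /g'; lat.
have g_t : g <= t by exact: leIr.
have g_uv : g <= u `|` v by exact: leIl.
have step1 x1 y1 z1 : diamond b x1 y1 z1 t -> g <= x1 `|` g'.
  move=> dia1; have [[b_x b_y b_z x_t y_t] z_t] := diamond_sub dia1.
  have [[_ yz _] [xy _ xz]] := dia1.
  have h := nldL (y1 `&` (g `|` x1)) (z1 `&` (g `|` x1)) x1 t (v `|` x1) (u `|` x1)
    ltac:(lat) ltac:(lat) ltac:(lat) ltac:(lat) ltac:(lat).
  have h1 : y1 `&` (g `|` x1) `&` (z1 `&` (g `|` x1)) <= x1.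
    by apply: (@le_trans _ _ (y1 `&` z1)); [lat|rewrite yz].
  have {}h := h h1 ltac:(lat).
  have g1 : g <= (y1 `&` (g `|` x1)) `|` x1.
    have := modL x1 (g `|` x1) y1 ltac:(lat); rewrite xy => h2.
    have : g <= (g `|` x1) `&` t by lat.
    by move=> /le_trans/(_ h2) h3; apply: (le_trans h3); lat.
  have g2 : g <= (z1 `&` (g `|` x1)) `|` x1.
    have := modL x1 (g `|` x1) z1 ltac:(lat); rewrite xz => h2.
    have : g <= (g `|` x1) `&` t by lat.
    by move=> /le_trans/(_ h2) h3; apply: (le_trans h3); lat.
  have g3 : g <= ((u `|` x1) `&` t) `|` ((v `|` x1) `&` t).
    by apply: le_trans h; rewrite lexI g1 g2.
  apply: (le_trans g3).
  have e1 := modL x1 t u x_t; have e2 := modL x1 t v x_t.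
  rewrite leUx; apply/andP; split.
    rewrite meetC (joinC u); apply: (le_trans e1); rewrite /g'.
    by lat.
  rewrite meetC (joinC v); apply: (le_trans e2); rewrite /g'.
  by lat.
have gx := step1 _ _ _ dia; have gy := step1 _ _ _ (diamond_rot dia).
have [[b_x b_y b_z x_t y_t] z_t] := diamond_sub dia.
have [[xy _ _] _] := dia.
have h := nldL (x `&` g) (y `&` g) g' t (v `|` g') (u `|` g')
    ltac:(lat) ltac:(lat) ltac:(lat) ltac:(lat) ltac:(lat).
have h1 : x `&` g `&` (y `&` g) <= g'.
  by apply: (@le_trans _ _ (x `&` y)); [lat|rewrite xy].
have {}h := h h1 ltac:(lat).
have g1 : g <= (x `&` g) `|` g'.
  have := modL g' g x g'_g; rewrite (joinC g') (meet_l gx).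
  by rewrite joinC (meetC g).
have g2 : g <= (y `&` g) `|` g'.
  have := modL g' g y g'_g; rewrite (joinC g') (meet_l gy).
  by rewrite joinC (meetC g).
have {h g1 g2} h : g <= ((u `|` g') `&` t) `|` ((v `|` g') `&` t).
  by apply: le_trans h; rewrite lexI g1 g2.
apply: (le_trans h).
have g'_t : g' <= t by exact: le_trans g_t.
have e1 := modL g' t u g'_t; have e2 := modL g' t v g'_t.
rewrite leUx; apply/andP; split.
  by rewrite meetC (joinC u); apply: (le_trans e1); rewrite /g'; lat.
by rewrite meetC (joinC v); apply: (le_trans e2); rewrite /g'; lat.
Qed.

(** With [k] the left-hand side, modular cancellation against [t] gives [w = w \/ k] once
    [t /\ (w \/ k) <= w]. The linked-diamond condition bounds [t /\ (w \/ k)] by [b \/ (t /\ w)],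
    and [t /\ b <= w] finishes. *)
Lemma joinI_bottom_pair b x y t w : modular L -> no_linked_diamonds L ->
  b <= x -> b <= y -> t <= x `|` y -> t `&` x <= w -> t `&` y <= w ->
  (w `|` t) `&` b <= w.
Proof.
move=> modL nldL b_x b_y t_xy tx_w ty_w.
pose k := (w `|` t) `&` b.
have k_b : k <= b by exact: leIr.
have k_wt : k <= w `|` t by exact: leIl.
have h := nldL t (w `&` (t `|` k)) (k `|` (t `&` w)) (t `|` b)
  (y `|` (t `&` w)) (x `|` (t `&` w)) ltac:(lat) ltac:(lat) ltac:(lat)
  ltac:(lat) ltac:(lat) ltac:(lat) ltac:(lat).
have e1 u : b <= u -> t `&` u <= w ->
    (u `|` (t `&` w)) `&` (t `|` b) <= b `|` (t `&` w).
  move=> b_u tu_w.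
  have a1 := modL (t `&` w) (t `|` b) u ltac:(lat).
  have a2 := modL b u t b_u.
  have a3 : (u `|` (t `&` w)) `&` (t `|` b) <= (t `|` b) `&` ((t `&` w) `|` u).
    by lat.
  apply: (le_trans a3); apply: (le_trans a1); rewrite leUx; apply/andP; split.
    by lat.
  have a4 : (t `|` b) `&` u <= u `&` (b `|` t) by lat.
  apply: (le_trans a4); apply: (le_trans a2).
  by rewrite leUx; apply/andP; split; lat.
have {}h : t `&` (w `|` k) <= b `|` (t `&` w).
  apply: (@le_trans _ _ ((t `|` (k `|` t `&` w)) `&`
      (w `&` (t `|` k) `|` (k `|` t `&` w)))).
    rewrite lexI; apply/andP; split; first by lat.
    have := modL k (t `|` k) w ltac:(lat) => a.
    have a1 : t `&` (w `|` k) <= (t `|` k) `&` (k `|` w) by lat.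
    by apply: (le_trans a1); apply: (le_trans a); lat.
  apply: (le_trans h); rewrite leUx; apply/andP; split.
    exact: e1.
  exact: e1.
have tw : t `&` (w `|` k) <= w.
  have a := modL (t `&` w) t b ltac:(lat).
  have a1 : t `&` (w `|` k) <= t `&` ((t `&` w) `|` b) by lat.
  by apply: (le_trans a1); apply: (le_trans a); lat.
have wk : w = w `|` k.
  apply: (modular_cancel (z := t)) => //; first by lat.
    by rewrite meetC.
  by lat.
by rewrite -/k wk leUr.
Qed.

(** The join with [u] is undone in stages: [joinI_bottom_pair] first replaces [u] by [u /\ x] and
    [u /\ y], and then removes [u /\ y] and [u /\ x] in turn, each time using the two sides of the
    diamond whose meets are already absorbed. *)
Lemma diamond_meetU b x y z t u w : modular L -> no_linked_diamonds L ->
  diamond b x y z t -> u <= t -> (w `|` u) `&` b <= w `|` (u `&` b).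
Proof.
move=> modL nldL dia u_t.
have [[b_x b_y b_z x_t y_t] z_t] := diamond_sub dia.
have [[xy yz xz] [jxy jyz jxz]] := dia.
have ux : (w `|` (u `&` x)) `&` b <= w `|` (u `&` b).
  have h := @joinI_bottom_pair b y z (u `&` x) (w `|` (u `&` b)) modL nldL b_y b_z.
  apply: (@le_trans _ _ (((w `|` u `&` b) `|` u `&` x) `&` b)); first by lat.
  apply: h.
  - by rewrite jyz; lat.
  - by rewrite -meetA xy leUr.
  - by rewrite -meetA xz leUr.
have uy v : (v `|` (u `&` y)) `&` b <= v `|` (u `&` b).
  have h := @joinI_bottom_pair b x z (u `&` y) (v `|` (u `&` b)) modL nldL b_x b_z.
  apply: (@le_trans _ _ (((v `|` u `&` b) `|` u `&` y) `&` b)); first by lat.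
  apply: h.
  - by rewrite jxz; lat.
  - by rewrite -meetA (meetC y) xy leUr.
  - by rewrite -meetA yz leUr.
have h := @joinI_bottom_pair b x y u ((w `|` (u `&` x)) `|` (u `&` y))
  modL nldL b_x b_y.
have {}h : (w `|` u) `&` b <= (w `|` (u `&` x)) `|` (u `&` y).
  apply: (@le_trans _ _ ((w `|` u `&` x `|` u `&` y `|` u) `&` b)); first by lat.
  by apply: h; [rewrite jxy|lat|lat].
have h1 : (w `|` u) `&` b <= w `|` u `&` x `|` u `&` b.
  by apply: le_trans (uy _); lat.
have h2 : (w `|` u) `&` b <= (w `|` (u `&` b) `|` (u `&` x)) `&` b.
  by rewrite lexI leIr andbT; apply: (le_trans h1); lat.
apply: (le_trans h2).
have h3 := @joinI_bottom_pair b y z (u `&` x) (w `|` (u `&` b)) modL nldL b_y b_z.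
apply: h3.
- by rewrite jyz; lat.
- by rewrite -meetA xy leUr.
- by rewrite -meetA xz leUr.
Qed.

End LinkedDiamonds.

(** * Congruences attached to a diamond *)

Record congruence d (L : latticeType d) (R : L -> L -> Prop) : Prop := {
  cong_refl : forall x, R x x;
  cong_sym : forall x y, R x y -> R y x;
  cong_trans : forall y x z, R x y -> R y z -> R x z;
  cong_meet : forall w x y, R x y -> R (x `&` w) (y `&` w);
  cong_join : forall w x y, R x y -> R (x `|` w) (y `|` w)
}.

(** Finite subdirect irreducibility: equality is meet-irreducible among the congruences. *)
Definition finitely_irreducible d (L : latticeType d) : Prop :=
  forall R S : L -> L -> Prop, congruence R -> congruence S ->
  (forall x y, R x y -> S x y -> x = y) ->
  (forall x y, R x y -> x = y) \/ (forall x y, S x y -> x = y).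

Lemma congruence_kernel d (L : latticeType d) d' (M : latticeType d')
    (h : L -> M) :
  {morph h : x y / x `&` y} -> {morph h : x y / x `|` y} ->
  congruence (fun x y => h x = h y).
Proof.
move=> hI hU; split=> //.
- by move=> y x z -> ->.
- by move=> w x y; rewrite !hI => ->.
- by move=> w x y; rewrite !hU => ->.
Qed.

(** A lattice congruence is determined by the comparable pairs that it collapses. For transitivity,
    [y] is collapsed with [x \/ y \/ z] and with [x /\ y /\ z], and convexity shrinks the resulting
    interval. *)
Lemma congruence_interval d (L : latticeType d) (T : L -> L -> Prop) :
  (forall x, T x x) ->
  (forall s u v t, s <= u -> u <= v -> v <= t -> T s t -> T u v) ->
  (forall t s u, s <= t -> t <= u -> T s t -> T t u -> T s u) ->
  (forall w s t, s <= t -> T s t -> T (s `&` w) (t `&` w)) ->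
  (forall w s t, s <= t -> T s t -> T (s `|` w) (t `|` w)) ->
  congruence (fun x y => T (x `&` y) (x `|` y)).
Proof.
move=> T_refl T_conv T_trans T_meet T_join; split.
- by move=> x; rewrite meetxx joinxx.
- by move=> x y; rewrite meetC joinC.
- move=> y x z Txy Tyz.
  have up : T y (x `|` y `|` z).
    apply: (T_trans (y `|` z)); [by lat|by lat| |].
      by apply: T_conv Tyz; lat.
    have := T_join z _ _ (_ : x `&` y <= x `|` y) Txy => /(_ ltac:(lat)).
    by apply: T_conv; lat.
  have dn : T (x `&` y `&` z) y.
    apply: (T_trans (y `&` z)); [by lat|by lat| |].
      have := T_meet z _ _ (_ : x `&` y <= x `|` y) Txy => /(_ ltac:(lat)).
      by apply: T_conv; lat.
    by apply: T_conv Tyz; lat.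
  have := T_trans _ _ _ (_ : x `&` y `&` z <= y) (_ : y <= _) dn up.
  by move=> /(_ ltac:(lat) ltac:(lat)); apply: T_conv; lat.
- move=> w x y Txy; have := T_meet w _ _ (_ : x `&` y <= x `|` y) Txy.
  by move=> /(_ ltac:(lat)); apply: T_conv; lat.
- move=> w x y Txy; have := T_join w _ _ (_ : x `&` y <= x `|` y) Txy.
  by move=> /(_ ltac:(lat)); apply: T_conv; lat.
Qed.

Section DiamondCongruences.
Context {d : Order.disp_t} {L : latticeType d}.
Hypotheses (modL : modular L) (nldL : no_linked_diamonds L).
Variables (b x y z t : L).
Hypothesis dia : diamond b x y z t.

Let b_t : b <= t.
Proof. by have [[? _ _ ? _] _] := diamond_sub dia; lat. Qed.

Lemma diamond_project u : (u `&` t) `|` b = (u `|` b) `&` t.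
Proof. by rewrite [RHS]meetC joinC (joinC u b) modularE // [t `&` u]meetC. Qed.

Let nldL' := no_linked_diamonds_dual modL nldL.
Let modL' := modular_dual modL.

Lemma diamond_projectU u v :
  ((u `|` v) `&` t) `|` b = ((u `&` t) `|` b) `|` ((v `&` t) `|` b).
Proof.
apply/le_anti/andP; split; last by lat.
have h := diamond_joinI modL nldL dia (leUr _ u) (leUr _ v).
rewrite !diamond_project; apply: le_trans h; lat.
Qed.

Lemma diamond_projectI u v :
  ((u `&` v) `&` t) `|` b = ((u `&` t) `|` b) `&` ((v `&` t) `|` b).
Proof.
apply/le_anti/andP; split; first by lat.
have h : ((u `&` t) `|` b) `&` ((v `&` t) `|` b) <=
    ((u `&` t) `&` (v `&` t)) `|` b.
  exact: (@diamond_joinI _ L^d t x y z b (u `&` t) (v `&` t) modL' nldL'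
    (diamond_dual dia) (leIr _ u) (leIr _ v)).
by apply: (le_trans h); lat.
Qed.

(** For [u <= v] this says that [u] and [v] have the same meet with [b] and the same join with [t];
    in particular [b] and [t] are collapsed. *)
Let T u v := v `&` b <= u /\ v <= u `|` t.

(** Two bounds are not immediate: the one with [t] under meets and the one with [b] under joins.
    They come from the dual of [diamond_meetU] and from [diamond_meetU] itself. *)
Lemma diamond_congruence : congruence (fun u v => T (u `&` v) (u `|` v)).
Proof.
apply: congruence_interval; rewrite /T.
- by move=> u; split; lat.
- by move=> s u v r s_u u_v v_r [rs r_st]; split; lat.
- move=> r s u s_r r_u [rs r_st] [ur u_rt]; split; last by lat.
  by apply: le_trans rs; lat.
- move=> w s r s_r [rs r_st]; split; first by lat.
  have h : (r `&` w) `&` ((s `|` b) `|` t) <= ((r `&` w) `&` (s `|` b)) `|` t.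
    exact: (@diamond_meetU _ L^d t x y z b (s `|` b) (r `&` w) modL' nldL'
      (diamond_dual dia) (leUr _ s)).
  have e := modularE b modL s_r.
  apply: (@le_trans _ _ ((r `&` w) `&` ((s `|` b) `|` t))); first by lat.
  apply: (le_trans h); rewrite meetAC e.
  by rewrite (join_l rs).
- move=> w s r s_r [rs r_st]; split; last by lat.
  have h := diamond_meetU (s `|` w) modL nldL dia (leIr t r).
  have e := modularE t modL s_r.
  apply: (@le_trans _ _ ((s `|` w `|` r `&` t) `&` b)).
    by rewrite joinAC -e (meet_l r_st).
  by apply: (le_trans h); lat.
Qed.

(** Between [u /\ v] and [u \/ v], equal projections and equal meets with [b] force equal meets with
    [t]. Since the joins with [t] agree too, modularity collapses the interval. *)
Lemma diamond_congruences_disjoint u v :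
  (u `&` t) `|` b = (v `&` t) `|` b -> T (u `&` v) (u `|` v) -> u = v.
Proof.
move=> huv [Tb Tt].
have h : ((u `|` v) `&` t) `|` b = ((u `&` v) `&` t) `|` b.
  by rewrite diamond_projectU diamond_projectI huv joinxx meetxx.
have h1 : (u `|` v) `&` t <= u `&` v.
  have h2 : (u `&` v) `&` t <= (u `|` v) `&` t by lat.
  have h3 := modL b h2.
  have h4 : (u `|` v) `&` t <= ((u `|` v) `&` t) `&` ((u `&` v) `&` t `|` b).
    by rewrite -h; lat.
  apply: (le_trans h4); apply: (le_trans h3).
  rewrite leUx; apply/andP; split; first by lat.
  by apply: le_trans Tb; lat.
have h5 : u `|` v <= u `&` v.
  have h6 := modularE t modL (_ : u `&` v <= u `|` v).
  rewrite -{1}(meet_l Tt) h6; last by lat.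
  by rewrite leUx; apply/andP; split.
apply/le_anti/andP; split.
  exact: le_trans (leUl _ _) (le_trans h5 (leIr _ _)).
exact: le_trans (leUr _ _) (le_trans h5 (leIl _ _)).
Qed.

End DiamondCongruences.

(** * Diamonds in finitely irreducible lattices *)

Section Irreducible.
Context {d : Order.disp_t} {L : latticeType d}.
Implicit Types (b t u v w x y z : L).
Hypotheses (modL : modular L) (nldL : no_linked_diamonds L).
Hypothesis irrL : finitely_irreducible L.

(** The congruence of [diamond_congruence] collapses [b < t], so irreducibility makes the projection
    onto [[b, t]] injective; but it takes the same value at [u], [u \/ b] and [u /\ t]. *)
Lemma irreducible_diamond b x y z t : diamond b x y z t -> b < t ->
  forall u, b <= u /\ u <= t.
Proof.
move=> dia b_t u.
have c1 := @congruence_kernel _ L _ L (fun u => (u `&` t) `|` b)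
  (diamond_projectI modL nldL dia) (diamond_projectU modL nldL dia).
have c2 := diamond_congruence modL nldL dia.
have := irrL c1 c2 (diamond_congruences_disjoint modL nldL dia).
have {}b_t' := ltW b_t.
case=> [inj|triv]; last first.
  have : b = t.
    apply: triv; rewrite (meet_l b_t') (join_r b_t'); split; lat.
  by move=> bt; rewrite bt ltxx in b_t.
split.
  have <- : u `|` b = u; last by lat.
  apply: inj; apply/le_anti/andP; split; last by lat.
  rewrite (diamond_project modL dia (u `|` b)) (diamond_project modL dia u).
  by lat.
have <- : u `&` t = u; last by lat.
by apply: inj; rewrite -meetA meetxx.
Qed.

Lemma irreducible_diamond_atom b x y z t u : diamond b x y z t -> b < t ->
  u <= x -> u = b \/ u = x.
Proof.
move=> dia b_t u_x.
have top := irreducible_diamond dia b_t.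
have [b_u u_t] := top u.
have [[xy yz xz] [jxy jyz jxz]] := dia.
have [->|ub] := eqVneq u b; first by left.
right; apply/le_anti/andP; split=> //.
(* Perspectivities through [z] and [y] carry [u] to the other two sides. The resulting diamond is
   nondegenerate, so it spans the lattice; hence [x <= u \/ y], and modularity gives [x <= u]. *)
have dia' : diamond b u ((u `|` z) `&` y) ((u `|` y) `&` z) ((u `|` y) `&` (u `|` z)).
  have bot w : b <= w by case: (top w).
  split; split.
  - by apply/le_anti/andP; split=> //; rewrite -xy; lat.
  - by apply/le_anti/andP; split=> //; rewrite -yz; lat.
  - by apply/le_anti/andP; split=> //; rewrite -xz; lat.
  - by rewrite -modularE ?leUl // meetC.
  - have h1 := modularE y modL (_ : (u `|` y) `&` z <= u `|` z).
    have h2 := modularE z modL (leUr y u).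
    rewrite joinC -h1; last by lat.
    rewrite (joinC _ y) (meetC _ z) (meetC z) -h2 jyz (meet_l (y := t)).
      by rewrite meetC.
    by case: (top (u `|` y)).
  - by rewrite -modularE ?leUl.
have b_t' : b < (u `|` y) `&` (u `|` z).
  rewrite lt_neqAle; apply/andP; split; last by case: (top ((u `|` y) `&` (u `|` z))).
  apply: contra ub => /eqP e; apply/eqP/le_anti; rewrite b_u andbT e; lat.
have [_ x_t] := irreducible_diamond dia' b_t' x.
have := modL y u_x; rewrite xy (join_l b_u); apply: le_trans.
by rewrite lexI lexx /=; apply: (le_trans x_t); lat.
Qed.

End Irreducible.

(** * Quotients and subdirect separation *)

Definition no_chain4 d (L : latticeType d) : Prop :=
  forall u v w x : L, u < v -> v < w -> w < x -> False.

Lemma no_chain4_length d (L : latticeType d) (u v w : L) :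
  no_chain4 L -> u < v -> v < w -> has_length 2 L.
Proof.
move=> nc uv vw; split; first by exists [:: u; v; w]; rewrite /= uv vw.
by case=> [|a [|b [|c [|e s]]]] //= /and4P[ab bc ce _]; case: (nc _ _ _ _ ab bc ce).
Qed.

Lemma length_no_chain4 d (L : latticeType d) : has_length 2 L -> no_chain4 L.
Proof.
move=> [_ small] u v w x uv vw wx.
by have := small [:: u; v; w; x]; rewrite /= uv vw wx => /(_ isT).
Qed.

Lemma finitely_irreducible_dual d (L : latticeType d) :
  finitely_irreducible L -> finitely_irreducible L^d.
Proof.
have dual (R : L -> L -> Prop) : @congruence _ L^d R -> congruence R.
  by case=> r s t m j; split.
by move=> irrL R S /dual cR /dual cS; exact: irrL.
Qed.

(** In the distributive case, meeting and joining with [c] are endomorphisms whose kernels intersect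
    trivially, so one is injective and [c] is extreme. Otherwise a genuine diamond spans the
    lattice, and its side [x] is both an atom and a coatom. *)
Lemma irreducible_trichotomy d (L : latticeType d) :
  modular L -> no_linked_diamonds L -> finitely_irreducible L ->
  (forall c : L, (forall u, u <= c) \/ (forall u, c <= u)) \/ has_length 2 L.
Proof.
move=> modL nldL irrL.
have [dist|] := pselect (forall x y z : L,
    x `&` (y `|` z) <= (x `&` y) `|` (x `&` z)).
  left=> c.
  have distE (x y z : L) : x `&` (y `|` z) = (x `&` y) `|` (x `&` z).
    by apply/le_anti/andP; split; [exact: dist|lat].
  have distU (x y z : L) : (x `&` y) `|` z = (x `|` z) `&` (y `|` z).
    rewrite distE [(x `|` z) `&` y]meetC distE [(x `|` z) `&` z]meetC.
    rewrite [z `&` _]meet_l ?leUr // (meetC y x) -joinA; congr (_ `|` _).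
    by rewrite join_r // leIr.
  have c1 := @congruence_kernel _ L _ L (fun u => c `&` u).
  have c2 := @congruence_kernel _ L _ L (fun u => u `|` c).
  have := irrL _ _ (c1 _ _) (c2 _ _); case.
  - by move=> x y; apply/le_anti/andP; split; lat.
  - by move=> x y; rewrite distE.
  - by move=> x y; rewrite distU.
  - by move=> x y; apply/le_anti/andP; split; lat.
  - move=> u v cu cv.
    have le (x y : L) : c `&` x = c `&` y -> x `|` c = y `|` c -> x <= y.
      move=> cx cy; have : x <= x `&` (y `|` c) by rewrite -cy; lat.
      rewrite distE (meetC x c) cx => /le_trans; apply; lat.
    by apply/le_anti/andP; split; apply: le.
  - move=> inj; left=> u; have <- : u `|` c = c; last exact: leUl.
    by apply: inj; rewrite meetxx meet_l // leUr.
  - move=> inj; right=> u; have <- : c `&` u = c; last exact: leIr.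
    by apply: inj; rewrite joinxx join_r // leIl.
move=> /existsNP[x0 /existsNP[y0 /existsNP[z0 /negP ndist]]]; right.
have [b [x [y [z [t [dia b_t]]]]]] := nondistributive_diamond modL ndist.
have top u : u <= t by case: (irreducible_diamond modL nldL irrL dia b_t u).
have bot u : b <= u by case: (irreducible_diamond modL nldL irrL dia b_t u).
have atom u : u <= x -> u = b \/ u = x.
  exact: (irreducible_diamond_atom modL nldL irrL dia b_t).
have coatom u : x <= u -> u = t \/ u = x.
  exact: (@irreducible_diamond_atom _ L^d (modular_dual modL)
    (no_linked_diamonds_dual modL nldL) (finitely_irreducible_dual irrL)
    t x y z b u (diamond_dual dia) b_t).
have [[xy yz xz] [jxy jyz jxz]] := dia.
have b_x : b < x.
  rewrite lt_neqAle bot andbT; apply/eqP => bx; rewrite -bx in jxy jxz.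
  rewrite !(join_r (bot _)) in jxy jxz.
  by rewrite jxy jxz meetxx in yz; rewrite yz ltxx in b_t.
have x_t : x < t.
  rewrite lt_neqAle top andbT; apply/eqP => xt; rewrite xt in xy xz.
  rewrite !(meet_r (top _)) in xy xz.
  by rewrite xy xz joinxx in jyz; rewrite jyz ltxx in b_t.
apply: (no_chain4_length _ b_x x_t).
(* The two middle elements of a four-element chain differ from [x], so both are complements of [x],
   and modular cancellation identifies them. *)
move=> u v w s uv vw ws.
have lt_bF a : a < b -> False by move=> ab; have := lt_le_trans ab (bot a); rewrite ltxx.
have lt_tF a : t < a -> False by move=> ta; have := lt_le_trans ta (top a); rewrite ltxx.
have vx : v <> x.
  move=> vx; rewrite vx in vw; have [wt|wx] := coatom w (ltW vw).
    by rewrite wt in ws; exact: lt_tF ws.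
  by rewrite wx ltxx in vw.
have wx : w <> x.
  move=> wx; rewrite wx in vw; have [vb|vx'] := atom v (ltW vw).
    by rewrite vb in uv; exact: lt_bF uv.
  by rewrite vx' ltxx in vw.
have wx_b : w `&` x <= b.
  have [->|wx_x] := atom (w `&` x) (leIr _ _) => //.
  have [wt|//] := coatom w (eq_ind _ (fun a => a <= w) (leIl w x) _ wx_x).
  by rewrite wt in ws; case: (lt_tF _ ws).
have vx_t : t <= v `|` x.
  have [->|vx_x] := coatom (v `|` x) (leUr _ _) => //.
  have [vb|//] := atom v (eq_ind _ (fun a => v <= a) (leUl v x) _ vx_x).
  by rewrite vb in uv; case: (lt_bF _ uv).
have /eqP := modular_cancel modL (ltW vw) (le_trans wx_b (bot v))
  (le_trans (top w) vx_t).
by rewrite lt_eqF.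
Qed.

Local Open Scope quotient_scope.

Section Quotient.
Context {d : Order.disp_t} {L : latticeType d} {R : L -> L -> Prop}.
Hypothesis congR : congruence R.

Let r (x y : L) : bool := `[< R x y >].

Let r_refl : reflexive r.
Proof. by move=> x; apply/asboolP; exact: cong_refl. Qed.

Let r_sym : symmetric r.
Proof. by move=> x y; apply/asboolP/asboolP; exact: cong_sym. Qed.

Let r_trans : transitive r.
Proof. by move=> y x z /asboolP xy /asboolP yz; apply/asboolP; exact: cong_trans yz. Qed.

Let r_equiv := EquivRel r r_refl r_sym r_trans.

Definition quotient_lattice := {eq_quot r_equiv}.

Definition class_of (x : L) : quotient_lattice := \pi_quotient_lattice x.

Lemma class_ofP x y : class_of x = class_of y <-> R x y.
Proof.
split=> [/eqmodP/asboolP//|Rxy].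
by apply/eqmodP/asboolP.
Qed.

Lemma class_of_repr a : exists x, a = class_of x.
Proof. by exists (repr a); rewrite /class_of reprK. Qed.

HB.instance Definition _ := Choice.on quotient_lattice.

Let qmeet (a b : quotient_lattice) := class_of (repr a `&` repr b).
Let qjoin (a b : quotient_lattice) := class_of (repr a `|` repr b).

Let repr_class x : R (repr (class_of x)) x.
Proof. by apply/class_ofP; rewrite /class_of reprK. Qed.

Let qmeetE x y : qmeet (class_of x) (class_of y) = class_of (x `&` y).
Proof.
apply/class_ofP; apply: (cong_trans congR (cong_meet congR _ (repr_class x))).
by rewrite !(meetC x); exact: (cong_meet congR).
Qed.

Let qjoinE x y : qjoin (class_of x) (class_of y) = class_of (x `|` y).
Proof.
apply/class_ofP; apply: (cong_trans congR (cong_join congR _ (repr_class x))).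
by rewrite !(joinC x); exact: (cong_join congR).
Qed.

Let qmeetC : commutative qmeet.
Proof.
move=> a b; have [[x ->] [y ->]] := (class_of_repr a, class_of_repr b).
by rewrite !qmeetE meetC.
Qed.
Let qjoinC : commutative qjoin.
Proof.
move=> a b; have [[x ->] [y ->]] := (class_of_repr a, class_of_repr b).
by rewrite !qjoinE joinC.
Qed.
Let qmeetA : associative qmeet.
Proof.
move=> a b c; have [[x ->] [y ->]] := (class_of_repr a, class_of_repr b).
by have [z ->] := class_of_repr c; rewrite !qmeetE meetA.
Qed.
Let qjoinA : associative qjoin.
Proof.
move=> a b c; have [[x ->] [y ->]] := (class_of_repr a, class_of_repr b).
by have [z ->] := class_of_repr c; rewrite !qjoinE joinA.
Qed.
Let qjoinKI b a : qmeet a (qjoin a b) = a.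
Proof.
have [[x ->] [y ->]] := (class_of_repr a, class_of_repr b).
by rewrite qjoinE qmeetE joinKI.
Qed.
Let qmeetKU b a : qjoin a (qmeet a b) = a.
Proof.
have [[x ->] [y ->]] := (class_of_repr a, class_of_repr b).
by rewrite qmeetE qjoinE meetKU.
Qed.

Let qle (a b : quotient_lattice) := qmeet a b == a.
Let qle_refl : reflexive qle.
Proof. by move=> a; have [x ->] := class_of_repr a; rewrite /qle qmeetE meetxx. Qed.
Let qle_anti : antisymmetric qle.
Proof. by move=> a b /andP[/eqP ab /eqP ba]; rewrite -ab qmeetC ba. Qed.
Let qle_trans : transitive qle.
Proof. by move=> b a c /eqP ab /eqP bc; rewrite /qle -{1}ab -qmeetA bc ab. Qed.

HB.instance Definition _ :=
  Order.Le_isPOrder.Build d quotient_lattice qle_refl qle_anti qle_trans.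
HB.instance Definition _ :=
  Order.POrder_isLattice.Build d quotient_lattice
    qmeetC qjoinC qmeetA qjoinA qjoinKI qmeetKU (fun _ _ => erefl).

Lemma class_ofI : {morph class_of : x y / x `&` y}.
Proof. by move=> x y; exact/esym/qmeetE. Qed.

Lemma class_ofU : {morph class_of : x y / x `|` y}.
Proof. by move=> x y; exact/esym/qjoinE. Qed.

End Quotient.

Lemma eval_morph d (L : latticeType d) d' (M : latticeType d') (f : L -> M)
    (v : nat -> L) (t : lattice_term) :
  {morph f : x y / x `&` y} -> {morph f : x y / x `|` y} ->
  f (lattice_eval v t) = lattice_eval (f \o v) t.
Proof. by move=> fI fU; elim: t => //= t1 <- t2 <-; rewrite ?fI ?fU. Qed.

Lemma congruence_sub_antichain d (L : latticeType d) (a b : L) : a <> b ->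
  exists2 R : L -> L -> Prop, congruence R /\ ~ R a b &
    forall S : L -> L -> Prop, congruence S -> (forall x y, R x y -> S x y) ->
      ~ S a b -> forall x y, S x y -> R x y.
Proof.
move=> ab.
(* Reflexivity is left out because the union of the empty chain must satisfy [P]. Maximality
   restores it, since adding the diagonal preserves [P]. *)
pose P (S : set (L * L)) := [/\ forall x y, S (x, y) -> S (y, x),
  forall y x z, S (x, y) -> S (y, z) -> S (x, z),
  forall w x y, S (x, y) -> S (x `&` w, y `&` w),
  forall w x y, S (x, y) -> S (x `|` w, y `|` w) & ~ S (a, b)].
have [F FP Ftot|R [PR Rmax]] := @Zorn_bigcup _ P.
  split.
  - move=> x y [S FS Sxy]; exists S => //.
    by have [s _ _ _ _] := FP _ FS; exact: s.
  - move=> y x z [S FS Sxy] [S' FS' Sxy'].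
    have [_ t _ _ _] := FP _ FS; have [_ t' _ _ _] := FP _ FS'.
    have [SS'|S'S] := Ftot _ _ FS FS'.
      by exists S' => //; apply: t' Sxy'; exact: SS'.
    by exists S => //; apply: t Sxy _; exact: S'S.
  - move=> w x y [S FS Sxy]; exists S => //.
    by have [_ _ m _ _] := FP _ FS; exact: m.
  - move=> w x y [S FS Sxy]; exists S => //.
    by have [_ _ _ j _] := FP _ FS; exact: j.
  - by move=> [S FS Sab]; have [_ _ _ _] := FP _ FS; exact.
have max (S : set (L * L)) : P S -> (R `<=` S)%classic -> (S `<=` R)%classic.
  by move=> PS RS; apply: contrapT => nSR; apply: (Rmax S) => //; split.
have [s t m j nR] := PR.
have refl x : R (x, x).
  apply: (max (R `|` [set p | p.1 = p.2])%classic); [|by left|by right].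
  split=> /=.
  - by move=> u v [/s|/= uv]; [left|right].
  - move=> v u w [uv|/= uv] [vw|/= vw].
    + by left; exact: t vw.
    + by left; rewrite -vw.
    + by left; rewrite uv.
    + by right; rewrite /= uv.
  - by move=> w u v [/(m w)|/= uv]; [left|right; rewrite /= uv].
  - by move=> w u v [/(j w)|/= uv]; [left|right; rewrite /= uv].
  - by move=> [//|/=].
exists (fun x y => R (x, y)).
  by split.
move=> S cS RS nS x y Sxy.
apply: (max [set p | S p.1 p.2]%classic) => //=; last first.
  by move=> [u v]; exact: RS.
case: cS => _ sS tS mS jS; split=> //=.
Qed.

(** Birkhoff's argument: [R] is maximal among the congruences that do not relate [a] and [b], so
    every nontrivial congruence of the quotient relates their classes, and two such congruences
    cannot intersect in equality. *)
Theorem irreducible_separation d (L : latticeType d) (a b : L) : a <> b ->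
  exists (R : L -> L -> Prop) (congR : congruence R),
    ~ R a b /\ finitely_irreducible (quotient_lattice congR).
Proof.
move=> /congruence_sub_antichain[R [congR nR] Rmax].
exists R, congR; split=> // S T cS cT ST.
have key (U : quotient_lattice congR -> quotient_lattice congR -> Prop) :
    congruence U -> ~ U (class_of congR a) (class_of congR b) ->
    forall x y, U x y -> x = y.
  move=> cU nU x y.
  have [[u ->] [v ->]] := (class_of_repr x, class_of_repr y).
  move=> Uuv; apply/class_ofP.
  apply: (Rmax (fun x y => U (class_of congR x) (class_of congR y))) => //.
    case: cU => r s t m j; split=> //.
    - by move=> p q; exact: s.
    - by move=> p q w; exact: t.
    - by move=> p q w; rewrite !class_ofI; exact: m.
    - by move=> p q w; rewrite !class_ofU; exact: j.
  by move=> p q /(class_ofP congR) ->; exact: (cong_refl cU).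
have [Sab|nS] := pselect (S (class_of congR a) (class_of congR b)); last first.
  by left; exact: key.
right; apply: key => // Tab; apply: nR; apply/(class_ofP congR).
exact: ST.
Qed.

Lemma has_length_ord3 : has_length 2 'I_3.
Proof.
split; first by exists [:: inord 0; inord 1; inord 2]; rewrite /= !ltEord /= !inordK.
move=> s /lt_sorted_uniq/card_uniqP <-.
by rewrite -[X in (_ <= X)%N](card_ord 3) max_card.
Qed.

Theorem length2_separation (W : lattice_class) d (L : latticeType d) (a b : L) :
  is_variety W ->
  (forall d' (M : latticeType d'), W d' M -> modular M /\ no_linked_diamonds M) ->
  W d L -> a <> b ->
  exists (d' : Order.disp_t) (M : latticeType d') (f : L -> M),
    [/\ {morph f : x y / x `&` y}, {morph f : x y / x `|` y},
        has_length 2 M & f a <> f b].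
Proof.
move=> [E WE] Wgood WL /irreducible_separation[R [congR [nR irr]]].
have cI := class_ofI congR; have cU := class_ofU congR.
have WQ : W d (quotient_lattice congR).
  apply/WE => e Ee v.
  pose w n := projT1 (cid (class_of_repr (v n))).
  have -> : v = class_of congR \o w.
    by apply/funext => n; rewrite /w /=; case: cid.
  by rewrite -!(eval_morph _ _ cI cU); congr class_of; apply: (WE _ _).1.
have [modQ nldQ] := Wgood _ _ WQ.
have cab : class_of congR a <> class_of congR b by move/class_ofP.
have [two|] := irreducible_trichotomy modQ nldQ irr; last first.
  by exists d, (quotient_lattice congR), (class_of congR).
pose top (c : quotient_lattice congR) := `[< forall u, u <= c >].
(* Here the quotient has only two elements, so its length is not 2; it is sent to the two ends of
   the three-element chain instead. *)
pose g c : 'I_3 := if top c then ord_max else ord0.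
have topP (c : quotient_lattice congR) : reflect (forall u, u <= c) (top c) by exact: asboolP.
have gle (c e : quotient_lattice congR) : c <= e -> g c <= g e.
  rewrite /g; case: (topP c) => [tc|_] ce; last by rewrite leEord.
  by case: (topP e) => // -[] u; exact: le_trans (tc u) ce.
have bot (c : quotient_lattice congR) : ~ (forall u, u <= c) -> forall u, c <= u by case: (two c).
have gI : {morph g : c e / c `&` e}.
  move=> c e; have [tc|/bot bc] := pselect (forall u, u <= c).
    by rewrite meet_r // [RHS]meet_r //; exact: gle.
  by rewrite meet_l // [RHS]meet_l //; exact: gle.
have gU : {morph g : c e / c `|` e}.
  move=> c e; have [tc|/bot bc] := pselect (forall u, u <= c).
    by rewrite join_l // [RHS]join_l //; exact: gle.
  by rewrite join_r // [RHS]join_r //; exact: gle.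
exists _, 'I_3, (g \o class_of congR); split.
- by move=> x y /=; rewrite cI gI.
- by move=> x y /=; rewrite cU gU.
- exact: has_length_ord3.
- rewrite /= /g; case: (topP (class_of congR a)) => ta;
    case: (topP (class_of congR b)) => tb // _; apply: cab.
    by apply/le_anti; rewrite ta tb.
  by apply/le_anti; rewrite !bot.
Qed.

(** * The variety generated by lattices of length 2 *)

(** A failure [u < v] of the modular law would extend to a chain of four elements from [u /\ r] to
    [v \/ r]. *)
Lemma length2_modular d (L : latticeType d) : has_length 2 L -> modular L.
Proof.
move=> /length_no_chain4 nc p q r pq; apply: contrapT => /negP nle.
pose u := p `|` (q `&` r); pose v := q `&` (p `|` r).
have uv : u < v by rewrite lt_leAnge nle andbT /u /v; lat.
apply: (nc (u `&` r) u v (v `|` r)) => //; rewrite lt_leAnge ?leIl ?leUl /=;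
  apply: contra nle => h.
  have pr : p <= r by apply: le_trans (leUl _ _) (le_trans h (leIr _ _)).
  by rewrite (join_r pr); lat.
have rq : r <= q by apply: le_trans (leUr _ _) (le_trans h (leIl _ _)).
by rewrite (meet_r rq); lat.
Qed.

(** In a counterexample [al /\ be < e < w], so [w], and with it [m], is the top. The meets with [m]
    then disappear and [al \/ e <= z \/ y] suffices. *)
Lemma length2_no_linked_diamonds d (L : latticeType d) :
  has_length 2 L -> no_linked_diamonds L.
Proof.
move=> /length_no_chain4 nc al be e m y z al_m be_m e_m e_y e_z albe_e albe_yz.
apply: contrapT => /negP nle.
pose w := (al `|` e) `&` (be `|` e); pose j := (z `&` m) `|` (y `&` m).
have e_j : e <= j by rewrite /j; lat.
have e_w : e < w.
  rewrite lt_leAnge lexI !leUr /=; apply: contra nle => w_e.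
  exact: le_trans w_e e_j.
have albe_lt : al `&` be < e.
  rewrite lt_leAnge albe_e /=; apply: contra nle => e_albe.
  have [e_al e_be] : e <= al /\ e <= be by split; lat.
  rewrite (join_l e_al) (join_l e_be); exact: le_trans albe_e e_j.
have top u : u <= w.
  apply: contrapT => /negP u_w; apply: (nc _ _ _ (w `|` u) albe_lt e_w).
  by rewrite lt_leAnge leUl /=; apply: contra u_w; apply: le_trans (leUr _ _).
have w_m : w <= m by rewrite /w; lat.
have z_m := le_trans (top z) w_m; have y_m := le_trans (top y) w_m.
case/negP: nle; rewrite (meet_l z_m) (meet_l y_m).
have al_zy : al <= z `|` y by rewrite joinC; apply: le_trans albe_yz; lat.
by apply: (le_trans (leIl _ _)); lat.
Qed.

Definition length2_identities : set (lattice_term * lattice_term) :=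
  fun e => forall d (L : latticeType d), has_length 2 L ->
    forall v : nat -> L, lattice_eval v e.1 = lattice_eval v e.2.

Lemma M_omegaP d (L : latticeType d) :
  M_omega L <-> satisfies L length2_identities.
Proof.
split=> [ML|sat V [E VE] subV].
  apply: (ML (fun d L => satisfies L length2_identities)).
    by exists length2_identities.
  by move=> d' M lenM e; apply.
by apply/VE => e Ee; apply: sat => d' M lenM; exact: ((VE _ _).1 (subV _ _ lenM) e Ee).
Qed.

Lemma M_omega_variety : is_variety M_omega.
Proof. by exists length2_identities => d L; exact: M_omegaP. Qed.

Lemma M_omega_le (s t : lattice_term) d (L : latticeType d) :
  (forall d' (M : latticeType d'), has_length 2 M ->
    forall v : nat -> M, lattice_eval v s <= lattice_eval v t) ->
  M_omega L -> forall v : nat -> L, lattice_eval v s <= lattice_eval v t.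
Proof.
move=> st /M_omegaP sat v; apply/meet_idPl.
by apply: (sat (Meet s t, s)) => d' M lenM w /=; apply/meet_idPl; exact: st.
Qed.

Lemma M_omega_modular d (L : latticeType d) : M_omega L -> modular L.
Proof.
move=> ML p q r pq.
(* Replacing [p] by [p /\ q] builds the premise [p <= q] into the terms. *)
pose P := Meet (Var 0) (Var 1).
have := @M_omega_le (Meet (Var 1) (Join P (Var 2))) (Join P (Meet (Var 1) (Var 2)))
  d L _ ML (nth r [:: p; q; r]).
rewrite /= (meet_l pq); apply=> d' M /length2_modular modM v /=.
by apply: modM; exact: leIr.
Qed.

Lemma M_omega_no_linked_diamonds d (L : latticeType d) :
  M_omega L -> no_linked_diamonds L.
Proof.
move=> ML al be e m y z al_m be_m e_m e_y e_z albe_e albe_yz.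
(* Each variable is replaced by a term; these terms satisfy the premises under every valuation and
   return the given elements when the premises already hold. *)
pose Y0 := Var 4; pose Z0 := Var 5.
pose A := Meet (Var 0) (Join Y0 Z0); pose B := Meet (Var 1) (Join Y0 Z0).
pose E := Join (Var 2) (Meet A B); pose Y := Join Y0 E; pose Z := Join Z0 E.
pose M := Join (Var 3) (Join A (Join B E)).
have := @M_omega_le (Meet (Join A E) (Join B E)) (Join (Meet Z M) (Meet Y M))
  d L _ ML (nth z [:: al; be; e; m; y; z]).
have alE : al `&` (y `|` z) = al by apply: meet_l; lat.
have beE : be `&` (y `|` z) = be by apply: meet_l; lat.
have mE : m `|` (al `|` (be `|` e)) = m by apply: join_l; lat.
rewrite /= alE beE (join_l albe_e) mE (join_l e_y) (join_l e_z); apply.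
move=> d' N /length2_no_linked_diamonds nldN v /=.
by apply: nldN; lat.
Qed.

(** * Transferability inside [M_omega] *)

Definition D4_map d (L : latticeType d) (p0 p1 q0 q1 : L) (x : D4) : L :=
  match x with
  | D4_0 => p0 `&` p1 | D4_a0 => p0 | D4_a1 => p1 | D4_c => p0 `|` p1
  | D4_b0 => q0 | D4_b1 => q1 | D4_1 => q0 `|` q1
  end.

(** [D4] is presented by its four generators and one relation, so constructing a homomorphism
    amounts to solving a single equation in the target. *)
Lemma D4_map_morph d (L : latticeType d) (p0 p1 q0 q1 : L) :
  p0 `|` p1 = q0 `&` q1 ->
  {morph D4_map p0 p1 q0 q1 : x y / x `&` y} /\
  {morph D4_map p0 p1 q0 q1 : x y / x `|` y}.
Proof.
move=> pq.
have [p0q0 p0q1] : p0 <= q0 /\ p0 <= q1.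
  by apply/andP; rewrite -lexI -pq leUl.
have [p1q0 p1q1] : p1 <= q0 /\ p1 <= q1.
  by apply/andP; rewrite -lexI -pq leUr.
have qp : q0 `&` q1 <= p0 `|` p1 by rewrite pq.
split=> x y.
  have -> : x `&` y = D4_meet x y by [].
  by case: x; case: y; rewrite /D4_meet /=; apply/le_anti/andP; split; lat.
have -> : x `|` y = D4_join x y by [].
by case: x; case: y; rewrite /D4_join /=; apply/le_anti/andP; split; lat.
Qed.

Lemma morph_le d (L : latticeType d) d' (M : latticeType d') (f : L -> M) :
  {morph f : x y / x `&` y} -> {homo f : x y / x <= y}.
Proof. by move=> fI x y /meet_idPl xy; rewrite -xy fI leIr. Qed.

Lemma lmorphism_of d (L : latticeType d) d' (M : latticeType d') (f : L -> M) :
  {morph f : x y / x `&` y} -> {morph f : x y / x `|` y} ->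
  exists g : {lmorphism L -> M}, g =1 f.
Proof.
move=> fI fU.
pose m1 := Order.isOrderMorphism.Build _ _ _ _ f (morph_le fI).
pose m2 := Order.isMeetLatticeMorphism.Build _ _ _ _ f fI.
pose m3 := Order.isJoinLatticeMorphism.Build _ _ _ _ f fU.
by exists (HB.pack f m1 m2 m3 : {lmorphism L -> M}).
Qed.

(** The approximations satisfy [b0 /\ b1 <= e <= v]. In length 2, either [v = e], and [e] splits
    between [x1] and [y1], or [v] is the top, and [x2 \/ y2] reaches it. *)
Lemma lift_length2 d (L : latticeType d) (b0 b1 x1 y1 x2 y2 : L) :
  has_length 2 L ->
  let e := ((b0 `&` b1) `|` x1) `&` ((b0 `&` b1) `|` y1) in
  let v := (b0 `|` e) `&` (b1 `|` e) in
  b0 `&` b1 <= x1 `|` y1 -> v <= x2 `|` y2 ->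
  (x1 `&` e `|` x2 `&` v) `|` (y1 `&` e `|` y2 `&` v) =
  (b0 `|` v) `&` (b1 `|` v).
Proof.
move=> len2 e v v0_u1 v_u2; have modL := length2_modular len2.
have nc := length_no_chain4 len2.
have e_v : e <= v by rewrite /v; lat.
have v0_e : b0 `&` b1 <= e by rewrite /e; lat.
have e_split : e <= (x1 `&` e) `|` (y1 `&` e).
  have h := modular_median_dual x1 y1 (b0 `&` b1) modL.
  apply: (@le_trans _ _ ((x1 `&` (y1 `|` (b0 `&` b1))) `|`
                         (y1 `&` (x1 `|` (b0 `&` b1))))).
    by apply: le_trans h; rewrite /e; lat.
  rewrite /e; lat.
(* If both fail, [e < v < v \/ u] makes [e] the bottom, whence [v = b0 /\ b1 <= e], a
   contradiction. *)
have v_alt : v <= e \/ forall u, u <= v.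
  have [|nv_e] := boolP (v <= e); [by left|right=> u].
  apply: contrapT => /negP u_v.
  have lt_v : v < v `|` u.
    by rewrite lt_leAnge leUl /=; apply: contra u_v; apply: le_trans (leUr _ _).
  have lt_e : e < v by rewrite lt_leAnge e_v.
  have bot w : e <= w.
    apply: contrapT => /negP e_w; apply: (nc (e `&` w) _ _ _ _ lt_e lt_v).
    by rewrite lt_leAnge leIl /=; apply: contra e_w => h; apply: le_trans h (leIr _ _).
  by case/negP: nv_e; rewrite /v (join_l (bot b0)) (join_l (bot b1)).
have -> : (b0 `|` v) `&` (b1 `|` v) = v.
  apply/le_anti/andP; split; last by lat.
  have [v_e|//] := v_alt.
  have ev : v = e by apply/le_anti/andP.
  by rewrite ev -/v; lat.
apply/le_anti/andP; split; first by lat.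
have [v_e|top] := v_alt; first by apply: (le_trans v_e); apply: (le_trans e_split); lat.
by apply: (le_trans v_u2); rewrite (meet_l (top x2)) (meet_l (top y2)); lat.
Qed.

(** Each of the four pairs consists of a join-irreducible element and the largest element not above
    it; sharpness need only be tested at these pairs. *)
Lemma D4_nle (x y : D4) : ~~ (x <= y) ->
  [\/ D4_a0 <= x /\ y <= D4_a1, D4_a1 <= x /\ y <= D4_a0,
      D4_b0 <= x /\ y <= D4_b1 | D4_b1 <= x /\ y <= D4_b0].
Proof.
by case: x; case: y => // _; first
  [by apply: Or41|by apply: Or42|by apply: Or43|by apply: Or44].
Qed.

Theorem M_omega_sharply_transferable (V : lattice_class) :
  subclass V M_omega -> sharply_transferable D4 V.
Proof.
move=> subV d L /subV ML phi phi_inj.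
have sub x y : phi x <= phi y -> x <= y.
  by move=> /meet_idPl; rewrite -omorphI => /phi_inj/meet_idPl.
have pick x y : ~~ (x <= y) -> exists2 u, ideal_set (phi x) u & ~ ideal_set (phi y) u.
  move=> nxy; apply: contrapT => no; case/negP: nxy; apply/sub/ideal_leP => u xu.
  by apply: contrapT => nyu; apply: no; exists u.
have up x y : x <= y -> forall u, ideal_set (phi x) u -> ideal_set (phi y) u.
  by move=> /meet_idPl <-; rewrite omorphI => u [].
have joinP u : ideal_set (phi D4_c) u ->
    exists x y, [/\ ideal_set (phi D4_a0) x, ideal_set (phi D4_a1) y & u <= x `|` y].
  have -> : D4_c = D4_a0 `|` D4_a1 by [].
  by rewrite omorphU.
have meetP u : ideal_set (phi D4_b0) u -> ideal_set (phi D4_b1) u -> ideal_set (phi D4_c) u.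
  have -> : D4_c = D4_b0 `&` D4_b1 by [].
  by rewrite omorphI.
have [x0 x0_a0 x0_a1] := pick D4_a0 D4_a1 isT.
have [y0 y0_a1 y0_a0] := pick D4_a1 D4_a0 isT.
have [c0 c0_b0 c0_b1] := pick D4_b0 D4_b1 isT.
have [c1 c1_b1 c1_b0] := pick D4_b1 D4_b0 isT.
have joinI x u w : ideal_set (phi x) u -> ideal_set (phi x) w -> ideal_set (phi x) (u `|` w).
  by move=> *; apply/ideal_joinE.
have down x u w : u <= w -> ideal_set (phi x) w -> ideal_set (phi x) u.
  exact: ideal_down.
(* Adding [x0 \/ y0] on both sides keeps it below [b0 /\ b1], and later below [p0 \/ p1]; this keeps
   [p0] out of [phi D4_a1] and [p1] out of [phi D4_a0]. *)
pose b0 := c0 `|` (x0 `|` y0); pose b1 := c1 `|` (x0 `|` y0).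
have u0_c : ideal_set (phi D4_c) (x0 `|` y0).
  by apply: joinI; [apply: up x0_a0|apply: up y0_a1].
have b0_b0 : ideal_set (phi D4_b0) b0 by apply: joinI => //; apply: up u0_c.
have b1_b1 : ideal_set (phi D4_b1) b1 by apply: joinI => //; apply: up u0_c.
have v0_c : ideal_set (phi D4_c) (b0 `&` b1).
  by apply: meetP; [apply: down b0_b0|apply: down b1_b1]; lat.
have [x1 [y1 [x1_a0 y1_a1 v0_u1]]] := joinP _ v0_c.
pose e := ((b0 `&` b1) `|` x1) `&` ((b0 `&` b1) `|` y1).
have e_c : ideal_set (phi D4_c) e.
  apply: (@down _ _ ((b0 `&` b1) `|` x1)); first exact: leIl.
  by apply: joinI => //; apply: up x1_a0.
pose v := (b0 `|` e) `&` (b1 `|` e).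
have v_c : ideal_set (phi D4_c) v.
  apply: meetP.
    by apply: (@down _ _ (b0 `|` e)); [exact: leIl|apply: joinI => //; apply: up e_c].
  by apply: (@down _ _ (b1 `|` e)); [exact: leIr|apply: joinI => //; apply: up e_c].
have [x2 [y2 [x2_a0 y2_a1 v_u2]]] := joinP _ v_c.
pose p0 := x1 `&` e `|` x2 `&` v; pose p1 := y1 `&` e `|` y2 `&` v.
pose q0 := b0 `|` v; pose q1 := b1 `|` v.
have pq : p0 `|` p1 = q0 `&` q1.
  apply: contrapT => neq.
  have [|d' [M [h [hI hU len2]]]] := length2_separation M_omega_variety _ ML neq.
    by move=> d' M MM; split; [exact: M_omega_modular|exact: M_omega_no_linked_diamonds].
  have hle z w : z <= w -> h z <= h w.
    by move=> /meet_idPl <-; rewrite hI leIr.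
  apply; have h1 := hle _ _ v0_u1; have h2 := hle _ _ v_u2.
  rewrite /v /e !(hI, hU) in h1 h2.
  by rewrite /p0 /p1 /q0 /q1 /v /e !(hI, hU); exact: lift_length2.
have [fI fU] := D4_map_morph pq; have [f fE] := lmorphism_of fI fU.
have p0_a0 : ideal_set (phi D4_a0) p0.
  by apply: joinI; [apply: down x1_a0|apply: down x2_a0]; exact: leIl.
have p1_a1 : ideal_set (phi D4_a1) p1.
  by apply: joinI; [apply: down y1_a1|apply: down y2_a1]; exact: leIl.
have q0_b0 : ideal_set (phi D4_b0) q0 by apply: joinI => //; apply: up v_c.
have q1_b1 : ideal_set (phi D4_b1) q1 by apply: joinI => //; apply: up v_c.
have u0_pq : x0 `|` y0 <= p0 `|` p1.
  by rewrite pq /q0 /q1 /b0 /b1; lat.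
have p0_a1 : ~ ideal_set (phi D4_a1) p0.
  move=> h; apply: x0_a1; apply: (@down _ _ (p0 `|` p1)); last exact: joinI.
  exact: le_trans (leUl _ _) u0_pq.
have p1_a0 : ~ ideal_set (phi D4_a0) p1.
  move=> h; apply: y0_a0; apply: (@down _ _ (p0 `|` p1)); last exact: joinI.
  exact: le_trans (leUr _ _) u0_pq.
have q0_b1 : ~ ideal_set (phi D4_b1) q0.
  by move=> h; apply: c0_b1; apply: down h; rewrite /q0 /b0; lat.
have q1_b0 : ~ ideal_set (phi D4_b0) q1.
  by move=> h; apply: c1_b0; apply: down h; rewrite /q1 /b1; lat.
have fle x y : x <= y -> f x <= f y by move=> /meet_idPl <-; rewrite omorphI leIr.
have phi0 : phi D4_0 = phi D4_a0 `&` phi D4_a1 by exact: (omorphI phi D4_a0 D4_a1).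
exists f; split=> [|x y fxy].
  case; rewrite fE //=.
  - by rewrite phi0; split; [apply: down p0_a0|apply: down p1_a1]; lat.
  - by apply: joinI; [apply: up p0_a0|apply: up p1_a1].
  - by apply: joinI; [apply: up q0_b0|apply: up q1_b1].
apply: contrapT => /negP/D4_nle[] [jx ym].
- by apply: p0_a1; rewrite -[p0]/(D4_map p0 p1 q0 q1 D4_a0) -fE; apply: down (up _ _ ym _ fxy); exact: fle.
- by apply: p1_a0; rewrite -[p1]/(D4_map p0 p1 q0 q1 D4_a1) -fE; apply: down (up _ _ ym _ fxy); exact: fle.
- by apply: q0_b1; rewrite -[q0]/(D4_map p0 p1 q0 q1 D4_b0) -fE; apply: down (up _ _ ym _ fxy); exact: fle.
- by apply: q1_b0; rewrite -[q1]/(D4_map p0 p1 q0 q1 D4_b1) -fE; apply: down (up _ _ ym _ fxy); exact: fle.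
Qed.

(** * Lattices of propagating sequences *)

(** [D4] is distributive: its four prime filters embed it into a power of the chain [lo < hi], which
    is a sublattice of [K]. *)
Lemma D4_satisfies E d (K : latticeType d) (lo hi : K) :
  lo < hi -> satisfies K E -> satisfies D4 E.
Proof.
move=> lo_hi sat t Et v.
have le := ltW lo_hi.
have key (h : D4 -> K) : {morph h : x y / x `&` y} -> {morph h : x y / x `|` y} ->
    h (lattice_eval v t.1) = h (lattice_eval v t.2).
  by move=> hI hU; rewrite !(eval_morph _ _ hI hU); exact: sat.
have fa0 := key (fun x => if D4_a0 <= x then hi else lo).
have fa1 := key (fun x => if D4_a1 <= x then hi else lo).
have fb0 := key (fun x => if D4_b0 <= x then hi else lo).
have fb1 := key (fun x => if D4_b1 <= x then hi else lo).
have meetE (x y : D4) : x `&` y = D4_meet x y by [].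
have joinE (x y : D4) : x `|` y = D4_join x y by [].
have {}fa0 := fa0 ltac:(by do 2!case; rewrite meetE /= ?meetxx ?(meet_l le) ?(meet_r le))
  ltac:(by do 2!case; rewrite joinE /= ?joinxx ?(join_l le) ?(join_r le)).
have {}fa1 := fa1 ltac:(by do 2!case; rewrite meetE /= ?meetxx ?(meet_l le) ?(meet_r le))
  ltac:(by do 2!case; rewrite joinE /= ?joinxx ?(join_l le) ?(join_r le)).
have {}fb0 := fb0 ltac:(by do 2!case; rewrite meetE /= ?meetxx ?(meet_l le) ?(meet_r le))
  ltac:(by do 2!case; rewrite joinE /= ?joinxx ?(join_l le) ?(join_r le)).
have {}fb1 := fb1 ltac:(by do 2!case; rewrite meetE /= ?meetxx ?(meet_l le) ?(meet_r le))
  ltac:(by do 2!case; rewrite joinE /= ?joinxx ?(join_l le) ?(join_r le)).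
have neq : hi = lo -> False by move=> hl; rewrite hl ltxx in lo_hi.
by move: (lattice_eval v t.1) (lattice_eval v t.2) fa0 fa1 fb0 fb1;
  do 2!case=> //=; move=> h1 h2 h3 h4; exfalso; apply: neq; congruence.
Qed.

Definition alt (T : Type) (n : nat) (u v : T) : T := if odd n then v else u.

Section Sequences.
Context {d : Order.disp_t} {K : latticeType d} (al be e m y z : K).

(** As homomorphisms from [D4], [floor n] collapses the lower square and [ceiling n] the upper one;
    the parity of [n] exchanges the images of the other two generators. *)
Definition floor n : D4 -> K :=
  D4_map (al `&` be) (al `&` be) (alt n al be) (alt n be al).

Definition ceiling n : D4 -> K :=
  D4_map (alt n z y) (alt n y z) (y `|` z) (y `|` z).

Lemma floor_morph n :
  {morph floor n : u v / u `&` v} /\ {morph floor n : u v / u `|` v}.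
Proof.
by apply: D4_map_morph; rewrite /alt joinxx; case: odd => //; rewrite meetC.
Qed.

Lemma ceiling_morph n :
  {morph ceiling n : u v / u `&` v} /\ {morph ceiling n : u v / u `|` v}.
Proof.
by apply: D4_map_morph; rewrite /alt meetxx; case: odd => //; rewrite joinC.
Qed.

(* [star] records the ideals containing the sequence.  The third condition makes
   a sequence that leaves the ideal below [m] at [n] exceed [e] at [n + 1], and
   the fourth one starts this chain reaction at [a0]. *)
Definition admissible (x : D4) (s : nat -> K) : Prop :=
  [/\ forall n, floor n x <= s n <= ceiling n x,
      exists N, forall n, (N <= n)%N -> s n = floor n x,
      forall n, s n <= m \/ e <= s n.+1
    & x <= D4_a1 \/ e <= s 0%N].

Record adm_seq : Type := AdmSeq {
  star : D4;
  seq_of : nat -> K;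
  seq_ofP : admissible star seq_of
}.

Lemma adm_seq_inj (s t : adm_seq) :
  star s = star t -> (forall n, seq_of s n = seq_of t n) -> s = t.
Proof.
case: s t => [x s sP] [x' t tP] /= xx' st; move: sP tP.
have -> : s = t by apply/funext.
by rewrite xx' => sP tP; congr AdmSeq; exact: Prop_irrelevance.
Qed.

(** The last two conditions offer an upper bound or a lower bound. If one factor satisfies the upper
    bound, so does the meet; otherwise both factors satisfy the lower bound. Joins are treated
    dually. *)
Lemma admissibleI x x' s t : admissible x s -> admissible x' t ->
  admissible (x `&` x') (fun n => s n `&` t n).
Proof.
move=> [sb [N sN] sm s0] [tb [N' tN] tm t0]; split.
- move=> n; have [fI _] := floor_morph n; have [cI _] := ceiling_morph n.
  have /andP[? ?] := sb n; have /andP[? ?] := tb n.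
  by rewrite fI cI !leI2.
- exists (maxn N N') => n; rewrite geq_max => /andP[/sN -> /tN ->].
  by have [fI _] := floor_morph n; rewrite fI.
- move=> n; case: (sm n) => [h|es]; first by left; apply: leIxl.
  case: (tm n) => [h|et]; first by left; apply: leIxr.
  by right; rewrite lexI es.
- case: s0 => [h|es]; first by left; apply: leIxl.
  case: t0 => [h|et]; first by left; apply: leIxr.
  by right; rewrite lexI es.
Qed.

Lemma admissibleU x x' s t : admissible x s -> admissible x' t ->
  admissible (x `|` x') (fun n => s n `|` t n).
Proof.
move=> [sb [N sN] sm s0] [tb [N' tN] tm t0]; split.
- move=> n; have [_ fU] := floor_morph n; have [_ cU] := ceiling_morph n.
  have /andP[? ?] := sb n; have /andP[? ?] := tb n.
  by rewrite fU cU !leU2.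
- exists (maxn N N') => n; rewrite geq_max => /andP[/sN -> /tN ->].
  by have [_ fU] := floor_morph n; rewrite fU.
- move=> n; case: (sm n) => [hs|es]; last by right; apply: lexUl.
  case: (tm n) => [ht|et]; last by right; apply: lexUr.
  by left; rewrite leUx hs.
- case: s0 => [hs|es]; last by right; apply: lexUl.
  case: t0 => [ht|et]; last by right; apply: lexUr.
  by left; rewrite leUx hs.
Qed.

HB.instance Definition _ := gen_eqMixin adm_seq.
HB.instance Definition _ := gen_choiceMixin adm_seq.

Definition adm_le (s t : adm_seq) : bool :=
  (star s <= star t) && `[< forall n, seq_of s n <= seq_of t n >].

Lemma adm_leP (s t : adm_seq) :
  reflect (star s <= star t /\ forall n, seq_of s n <= seq_of t n) (adm_le s t).
Proof. by apply: (iffP andP) => -[? ?]; split=> //; exact/asboolP. Qed.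

Lemma adm_le_refl : reflexive adm_le.
Proof. by move=> s; apply/adm_leP. Qed.

Lemma adm_le_anti : antisymmetric adm_le.
Proof.
move=> s t /andP[/adm_leP[st stn] /adm_leP[ts tsn]].
by apply: adm_seq_inj => [|n]; apply/le_anti; rewrite ?st ?ts ?stn ?tsn.
Qed.

Lemma adm_le_trans : transitive adm_le.
Proof.
move=> t s u /adm_leP[st stn] /adm_leP[tu tun].
by apply/adm_leP; split=> [|n]; [exact: le_trans tu|exact: le_trans (tun n)].
Qed.

HB.instance Definition _ :=
  Order.Le_isPOrder.Build d adm_seq adm_le_refl adm_le_anti adm_le_trans.

Lemma adm_seq_leP (s t : adm_seq) :
  reflect (star s <= star t /\ forall n, seq_of s n <= seq_of t n) (s <= t).
Proof. exact: adm_leP. Qed.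

Definition adm_meet (s t : adm_seq) := AdmSeq (admissibleI (seq_ofP s) (seq_ofP t)).
Definition adm_join (s t : adm_seq) := AdmSeq (admissibleU (seq_ofP s) (seq_ofP t)).

Lemma adm_lexI (s t u : adm_seq) : (s <= adm_meet t u) = (s <= t) && (s <= u).
Proof.
apply/adm_seq_leP/andP => /= [[]|[/adm_seq_leP[st stn] /adm_seq_leP[su sun]]].
  rewrite lexI => /andP[st su] h; split; apply/adm_seq_leP; split=> // n;
  by have := h n; rewrite lexI => /andP[].
by split=> [|n]; rewrite lexI ?st ?su ?stn ?sun.
Qed.

Lemma adm_leUx (s t u : adm_seq) : (adm_join s t <= u) = (s <= u) && (t <= u).
Proof.
apply/adm_seq_leP/andP => /= [[]|[/adm_seq_leP[su sun] /adm_seq_leP[tu tun]]].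
  rewrite leUx => /andP[su tu] h; split; apply/adm_seq_leP; split=> // n;
  by have := h n; rewrite leUx => /andP[].
by split=> [|n]; rewrite leUx ?su ?tu ?sun ?tun.
Qed.

HB.instance Definition _ :=
  Order.POrder_MeetJoin_isLattice.Build d adm_seq adm_lexI adm_leUx.

Lemma adm_seq_satisfies E :
  satisfies K E -> satisfies D4 E -> satisfies adm_seq E.
Proof.
move=> satK satD t Et v; apply: adm_seq_inj => [|n].
  have sI : {morph star : s t / s `&` t} by [].
  have sU : {morph star : s t / s `|` t} by [].
  by rewrite !(eval_morph _ _ sI sU); exact: satD.
have sI : {morph (fun s => seq_of s n) : s t / s `&` t} by [].
have sU : {morph (fun s => seq_of s n) : s t / s `|` t} by [].
by have := satK t Et ((fun s => seq_of s n) \o v); rewrite -!(eval_morph _ _ sI sU).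
Qed.

End Sequences.

(** * The projection to [D4] and the obstruction to a section *)

Definition splice (T : Type) (N : nat) (hi : nat -> T) (t : T) (lo : nat -> T)
    (n : nat) : T :=
  if (n < N)%N then hi n else if n == N then t else lo n.

Section Obstruction.
Context {d : Order.disp_t} {K : latticeType d} (al be e m y z : K).
Hypotheses (al_m : al <= m) (e_m : e <= m) (e_z : e <= z).
(** The first alternative serves the modular law, the second one the linked diamonds. *)
Hypothesis alt_hyp : e <= al /\ z <= m \/ be <= m /\ e <= y.
Hypotheses (albe_e : al `&` be <= e) (albe_y : al `&` be <= y).
Hypothesis albe_yz : al `|` be <= y `|` z.

Local Notation seqs := (adm_seq al be e m y z).
Local Notation floor := (floor al be).
Local Notation ceiling := (ceiling y z).

(** The value [t] answers a possible jump of [hi] just before it, whence [e <= t], and must permit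
    the floor just after it. *)
Lemma splice_admissible x N (hi : nat -> K) (t : K) :
  (forall n, floor n x <= hi n <= ceiling n x) ->
  floor N x <= t <= ceiling N x -> (forall n, hi n <= m \/ e <= hi n.+1) ->
  e <= t -> t <= m \/ e <= floor N.+1 x ->
  (forall n, floor n x <= m \/ e <= floor n.+1 x) ->
  x <= D4_a1 \/ e <= (if N is 0%N then t else hi 0%N) ->
  admissible al be e m y z x (splice N hi t (floor^~ x)).
Proof.
move=> hiP tP him e_t tm fm x0; split.
- move=> n; rewrite /splice; case: ifP => // _; case: eqP => [-> //|_].
  by have /andP[h1 h2] := hiP n; rewrite lexx (le_trans h1 h2).
- exists N.+1 => n Nn; rewrite /splice ltnNge (ltnW Nn) /=.
  by case: eqP Nn => // ->; rewrite ltnn.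
- move=> n; rewrite /splice; case: (ltngtP n N) => [nN|nN|->].
  + by case: (ltngtP n.+1 N) nN => // _ _; right.
  + by rewrite ltnNge (leqW (ltnW nN)) /= gtn_eqF // ltnS ltnW.
  + by rewrite ltnNge leqnSn /= gtn_eqF.
- by rewrite /splice; case: N {hiP tP tm} x0.
Qed.

Let l_z : al `&` be <= z. Proof. exact: le_trans e_z. Qed.
Let l_m : al `&` be <= m. Proof. exact: le_trans e_m. Qed.
Let e_yz : e <= y `|` z. Proof. exact: lexUr. Qed.
Let al_yz : al <= y `|` z. Proof. exact: le_trans (leUl _ _) albe_yz. Qed.
Let be_yz : be <= y `|` z. Proof. exact: le_trans (leUr _ _) albe_yz. Qed.
Let zm : z <= m \/ e <= y. Proof. by case: alt_hyp => -[]; [left|right]. Qed.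
Let bm : be <= m \/ e <= al. Proof. by case: alt_hyp => -[]; [right|left]. Qed.

(** Sequences over [D4_b0] and [D4_b1] descend through [t] at an index where their floor is [be] and
    the next floor is [al]; this fixes the parity of the splice index. If [e <= al], the ceiling
    itself will do; otherwise [be \/ e] stays below [m]. *)
Let turn : exists t, [/\ be <= t, e <= t, t <= y `|` z & t <= m \/ e <= al].
Proof.
case: alt_hyp => -[h1 h2]; first by exists (y `|` z); split=> //; right.
by exists (be `|` e); split; [lat|lat|lat|left; lat].
Qed.

(** The doubled index places the descent where the ceiling is [z], which lies above [e]; over
    [D4_a1] this takes an odd index. *)
Lemma seq_a0 N : exists s : seqs, star s = D4_a0 /\
  forall n, (n < N)%N -> seq_of s n = alt n z y.
Proof.
have P : admissible al be e m y z D4_a0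
    (splice N.*2 (fun n => alt n z y) e (floor^~ D4_a0)).
  apply: splice_admissible => /=.
  - by move=> n; rewrite /alt; case: odd => /=; apply/andP; split; lat.
  - by rewrite /alt odd_double; apply/andP; split; lat.
  - by move=> n; rewrite /alt /=; case: odd => /=; [right|].
  - by [].
  - by left.
  - by left.
  - by right; case: N.
exists (AdmSeq P); split=> // n nN; rewrite /= /splice.
by rewrite (leq_trans nN) // -addnn leq_addr.
Qed.

Lemma seq_a1 N : exists s : seqs, star s = D4_a1 /\
  forall n, (n < N)%N -> seq_of s n = alt n y z.
Proof.
have P : admissible al be e m y z D4_a1
    (splice N.*2.+1 (fun n => alt n y z) e (floor^~ D4_a1)).
  apply: splice_admissible => /=.
  - by move=> n; rewrite /alt; case: odd => /=; apply/andP; split; lat.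
  - by rewrite /alt /= odd_double /=; apply/andP; split; lat.
  - by move=> n; rewrite /alt /=; case: odd => /=; [|right].
  - by [].
  - by left.
  - by left.
  - by left.
exists (AdmSeq P); split=> // n nN; rewrite /= /splice.
by rewrite ltnS ltnW // (leq_trans nN) // -addnn leq_addr.
Qed.

Lemma seq_b0 N : exists s : seqs, star s = D4_b0 /\
  forall n, (n < N)%N -> seq_of s n = y `|` z.
Proof.
have [t [be_t e_t t_yz tm]] := turn.
have P : admissible al be e m y z D4_b0
    (splice N.*2.+1 (fun=> y `|` z) t (floor^~ D4_b0)).
  apply: splice_admissible => /=.
  - by move=> n; rewrite /alt; case: odd => /=; apply/andP; split; lat.
  - by rewrite /alt /= odd_double /= be_t.
  - by move=> n; right.
  - by [].
  - by rewrite /alt /= odd_double.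
  - by move=> n; rewrite /alt /=; case: odd => /=; [|left].
  - by right.
exists (AdmSeq P); split=> // n nN; rewrite /= /splice.
by rewrite ltnS ltnW // (leq_trans nN) // -addnn leq_addr.
Qed.

Lemma seq_b1 N : exists s : seqs, star s = D4_b1 /\
  forall n, (n < N)%N -> seq_of s n = y `|` z.
Proof.
have [t [be_t e_t t_yz tm]] := turn.
have P : admissible al be e m y z D4_b1
    (splice N.*2 (fun=> y `|` z) t (floor^~ D4_b1)).
  apply: splice_admissible => /=.
  - by move=> n; rewrite /alt; case: odd => /=; apply/andP; split; lat.
  - by rewrite /alt /= odd_double /= be_t.
  - by move=> n; right.
  - by [].
  - by rewrite /alt /= odd_double.
  - by move=> n; rewrite /alt /=; case: odd => /=; [left|].
  - by right; case: N.
exists (AdmSeq P); split=> // n nN; rewrite /= /splice.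
by rewrite (leq_trans nN) // -addnn leq_addr.
Qed.

Lemma star_surj x : exists s : seqs, star s = x.
Proof.
have [[s0 [e0 _]] [s1 [e1 _]]] := (seq_a0 0, seq_a1 0).
have [[t0 [f0 _]] [t1 [f1 _]]] := (seq_b0 0, seq_b1 0).
case: x; [exists (s0 `&` s1)|exists s0|exists s1|exists (s0 `|` s1)|exists t0
  |exists t1|exists (t0 `|` t1)] => //.
- by have -> : star (s0 `&` s1) = star s0 `&` star s1 by []; rewrite e0 e1.
- by have -> : star (s0 `|` s1) = star s0 `|` star s1 by []; rewrite e0 e1.
- by have -> : star (t0 `|` t1) = star t0 `|` star t1 by []; rewrite f0 f1.
Qed.

Definition star_set (x : D4) : set seqs := fun s => star s <= x.

Lemma star_set_nonempty x : (star_set x !=set0)%classic.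
Proof. by have [s sx] := star_surj x; exists s; rewrite /star_set sx. Qed.

Lemma star_set_joinE x (s t : seqs) :
  star_set x (s `|` t) <-> star_set x s /\ star_set x t.
Proof.
rewrite /star_set; have -> : star (s `|` t) = star s `|` star t by [].
by rewrite leUx; split=> /andP.
Qed.

Definition star_ideal (x : D4) : ideal seqs :=
  Ideal (star_set_nonempty x) (@star_set_joinE x).

Lemma star_idealI : {morph star_ideal : x y / x `&` y}.
Proof.
move=> x x'; apply/ideal_inj/seteqP; split=> s /=.
  by rewrite /star_set lexI => /andP[]; split.
by move=> [sx sx']; rewrite /star_set lexI sx.
Qed.

(** A sequence of the larger ideal follows its floor from some [N] on. Before [N] the two chosen
    sequences join above [y \/ z], which bounds every ceiling; afterwards it suffices that the floor
    preserves joins. *)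
Let cover (x x' : D4) :
  (forall N, exists s s' : seqs, [/\ star s = x, star s' = x' &
     forall n, (n < N)%N -> y `|` z <= seq_of s n `|` seq_of s' n]) ->
  star_ideal (x `|` x') <= star_ideal x `|` star_ideal x'.
Proof.
move=> cov; apply/ideal_leP => s sx; have [sb [N sN] _ _] := seq_ofP s.
have [s1 [s2 [s1x s2x' s12]]] := cov N.
exists s1, s2; split; [by rewrite /= /star_set s1x|by rewrite /= /star_set s2x'|].
apply/adm_seq_leP; split=> [|n].
  by have -> : star (s1 `|` s2) = star s1 `|` star s2 by []; rewrite s1x s2x'.
have -> : seq_of (s1 `|` s2) n = seq_of s1 n `|` seq_of s2 n by [].
have [nN|Nn] := ltnP n N.
  apply: le_trans (s12 _ nN); have /andP[_ h] := sb n; apply: (le_trans h).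
  by rewrite /ceiling /alt; case: (star s); case: odd => /=; lat.
have [fI fU] := floor_morph al be n.
rewrite sN //; apply: (le_trans (morph_le fI sx)); rewrite fU leU2 //.
  by have [b1 _ _ _] := seq_ofP s1; have /andP[] := b1 n; rewrite s1x.
by have [b2 _ _ _] := seq_ofP s2; have /andP[] := b2 n; rewrite s2x'.
Qed.

Lemma star_idealU : {morph star_ideal : x y / x `|` y}.
Proof.
have mono := morph_le star_idealI.
have cova : star_ideal (D4_a0 `|` D4_a1) <= star_ideal D4_a0 `|` star_ideal D4_a1.
  apply: cover => N; have [[s [sx sN]] [t [tx tN]]] := (seq_a0 N, seq_a1 N).
  by exists s, t; split=> // n nN; rewrite sN // tN // /alt; case: odd => //; lat.
have covb : star_ideal (D4_b0 `|` D4_b1) <= star_ideal D4_b0 `|` star_ideal D4_b1.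
  apply: cover => N; have [[s [sx sN]] [t [tx tN]]] := (seq_b0 N, seq_b1 N).
  by exists s, t; split=> // n nN; rewrite sN // leUl.
move=> x x'; apply/le_anti/andP; split; last by rewrite leUx !mono ?leUl ?leUr.
have [xx'|nxx'] := boolP (x <= x'); first by rewrite (join_r xx') leUr.
have [x'x|nx'x] := boolP (x' <= x); first by rewrite (join_l x'x) leUl.
by move: nxx' nx'x; case: x; case: x' => // _ _; rewrite joinC (joinC (star_ideal _)).
Qed.

Lemma star_ideal_inj : injective star_ideal.
Proof.
have sub x x' : star_ideal x = star_ideal x' -> x <= x'.
  move=> xx'; have [s sx] := star_surj x.
  have : ideal_set (star_ideal x) s by rewrite /= /star_set sx.
  by rewrite xx' /= /star_set sx.
by move=> x x' xx'; apply/le_anti; rewrite !sub.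
Qed.

(** If the inequality failed, [e] would lie below every term of the sequence over [D4_c]. That
    sequence ends at [al /\ be], and [e <= al /\ be] makes the inequality hold trivially. *)
Lemma no_section (f : {lmorphism D4 -> seqs}) :
  (forall x, star (f x) = x) ->
  (al `|` e) `&` (be `|` e) <= (z `&` m) `|` (y `&` m).
Proof.
move=> fstar; apply: contrapT => /negP nle.
have fcU n : seq_of (f D4_c) n = seq_of (f D4_a0) n `|` seq_of (f D4_a1) n.
  by rewrite (omorphU f D4_a0 D4_a1 : f D4_c = _).
have fcI n : seq_of (f D4_c) n = seq_of (f D4_b0) n `&` seq_of (f D4_b1) n.
  by rewrite (omorphI f D4_b0 D4_b1 : f D4_c = _).
have [a0b _ a0m a00] := seq_ofP (f D4_a0); have [a1b _ a1m _] := seq_ofP (f D4_a1).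
have [b0b _ _ _] := seq_ofP (f D4_b0); have [b1b _ _ _] := seq_ofP (f D4_b1).
rewrite !fstar in a0b a00 a1b b0b b1b.
have e_c n : e <= seq_of (f D4_c) n.
  elim: n => [|n IHn].
    by case: a00 => // h; rewrite fcU; apply: lexUl.
  have /andP[_ a0c] := a0b n; have /andP[_ a1c] := a1b n.
  have /andP[b0f _] := b0b n; have /andP[b1f _] := b1b n.
  rewrite fcU; case: (a0m n) => [a0_m|h]; last by apply: lexUl.
  case: (a1m n) => [a1_m|h]; last by apply: lexUr.
  (* With both values below [m], the ceilings bound their join by the right-hand side, while the
     floors and the induction hypothesis bound it below by the left-hand side. *)
  case/negP: nle; apply: (@le_trans _ _ (seq_of (f D4_c) n)).
    move: (IHn) b0f b1f; rewrite fcI lexI => /andP[e_b0 e_b1].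
    by rewrite /= /alt; case: odd => b0f b1f; lat.
  by rewrite fcU; move: a0c a1c; rewrite /= /alt; case: odd => a0c a1c; lat.
have [_ [N cN] _ _] := seq_ofP (f D4_c).
have := e_c N; rewrite cN // fstar /= joinxx lexI => /andP[e_al e_be].
case/negP: nle; rewrite (join_l e_al) (join_l e_be).
by apply: (le_trans albe_e); lat.
Qed.

End Obstruction.

(** * Conditions forced by transferability *)

Theorem transferable_obstruction (V : lattice_class) d (K : latticeType d)
    (al be e m y z : K) :
  is_variety V -> sharply_transferable D4 V -> V d K ->
  al <= m -> e <= m -> e <= z -> e <= al /\ z <= m \/ be <= m /\ e <= y ->
  al `&` be <= e -> al `&` be <= y -> al `|` be <= y `|` z ->
  (al `|` e) `&` (be `|` e) <= (z `&` m) `|` (y `&` m).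
Proof.
move=> [E VE] tr VK al_m e_m e_z hyp albe_e albe_y albe_yz.
pose w := (al `|` e) `&` (be `|` e); pose j := (z `&` m) `|` (y `&` m).
apply: contrapT => nle; have nle' : ~~ (w <= j) by exact/negP.
(* A failure makes [K] nontrivial, which brings [D4], and with it the lattice of sequences, into
   [V]. *)
have lo_hi : j < j `|` w.
  by rewrite lt_leAnge leUl /=; apply: contra nle' => h;
    exact: le_trans (leUr _ _) h.
have satK := (VE _ _).1 VK.
have VL : V d (adm_seq al be e m y z).
  by apply/VE; apply: adm_seq_satisfies => //; exact: D4_satisfies lo_hi satK.
have [phi phiE] := lmorphism_of
  (star_idealI al_m e_m e_z hyp albe_e albe_y albe_yz)
  (star_idealU al_m e_m e_z hyp albe_e albe_y albe_yz).
have phi_inj : injective phi.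
  move=> x x'; rewrite !phiE; exact: star_ideal_inj.
have [f [fphi fle]] := tr _ _ VL phi phi_inj.
have fstar x : star (f x) = x.
  have fx : star (f x) <= x by have := fphi x; rewrite phiE.
  (* Sharpness is applied to the ideal of [star (f x)], which contains [f x]. *)
  by apply/le_anti; rewrite fx /=; apply: fle; rewrite phiE; exact: lexx.
by apply: nle; apply: no_section fstar.
Qed.

Lemma transferable_modular (V : lattice_class) d (K : latticeType d) :
  is_variety V -> sharply_transferable D4 V -> V d K -> modular K.
Proof.
move=> hV tr VK p q r pq.
pose A := q `&` (p `|` r); pose e := p `|` (q `&` r).
(* The pentagon formed by [e <= A] and [r] enters as [al = m = A], [be = y = r], [z = e]; the
   conclusion then forces [A <= e]. *)
have h := @transferable_obstruction V d K A r e A r e hV tr VK.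
have Ar_e : A `&` r <= e by rewrite /A /e; lat.
have e_A : e <= A by rewrite /A /e; lat.
have {}h := h (lexx _) e_A (lexx _) (or_introl (conj e_A e_A)) Ar_e (leIr _ _).
apply: (@le_trans _ _ ((A `|` e) `&` (r `|` e))); first by rewrite /A /e; lat.
have Ar_re : A `|` r <= r `|` e by rewrite /A /e; lat.
by apply: (le_trans (h Ar_re)); rewrite leUx; apply/andP; split; rewrite /A /e; lat.
Qed.

Lemma transferable_no_linked_diamonds (V : lattice_class) d (K : latticeType d) :
  is_variety V -> sharply_transferable D4 V -> V d K -> no_linked_diamonds K.
Proof.
move=> hV tr VK al be e m y z al_m be_m e_m e_y e_z albe_e albe_yz.
apply: (transferable_obstruction hV tr VK) => //; first by right.
exact: le_trans e_y.
Qed.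

Theorem theorem5p4 (V : lattice_class) (hV : is_variety V) :
  sharply_transferable D4 V <-> subclass V M_omega.
Proof.
split=> [tr d L VL|]; last exact: M_omega_sharply_transferable.
apply/M_omegaP => e Ee v; apply: contrapT => neq.
have [|d' [M [h [hI hU len2 []]]]] := length2_separation hV _ VL neq.
  move=> d' M VM; split; first exact: (transferable_modular hV tr VM).
  exact: (transferable_no_linked_diamonds hV tr VM).
by rewrite !(eval_morph _ _ hI hU); exact: Ee.
Qed.
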